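(* Let $k$ be an algebraically closed field of characteristic $p=2$. In each of the following cases, $\mathrm{Spec}\,R/I$ is $F$-liftable. (1) $R=k[x,y,z]$ and $I=(f)$, where $f=x^a+y^b+z^c+xyz$ for positive integers $a,b,c$ with $\frac1a+\frac1b+\frac1c<1$. (2) $R=k[x,y,z,w]$ and $I=(f,g)$, where $f=xy+z^a+w^b$ and $g=zw+x^c+y^d$ for integers $a,b,c,d\ge 2$ with at least one of them $\geq 3$.
   Context: A scheme $X$ of finite type over $k$ is $F$-liftable if there exist a flat morphism $\widetilde X\to\mathrm{Spec}\,W_2(k)$ (with $W_2(k)$ the ring of Witt vectors of length two), a closed immersion $i\colon X\hookrightarrow\widetilde X$ inducing an isomorphism $X\cong\widetilde X\times_{W_2(k)}k$, and a morphism $\widetilde F\colon\widetilde X\to\widetilde X$, compatible with the Witt vector Frobenius of $W_2(k)$, with $\widetilde F\circ i=i\circ F$, where $F$ is the absolute Frobenius of $X$. *)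

(* Defs.v *)
From HB Require Import structures.
From mathcomp Require Import all_boot all_order all_algebra.
From mathcomp Require Import generic_quotient ring_quotient.
From mathcomp Require Import boolp.
From mathcomp Require Import mpoly.

Set Implicit Arguments.
Unset Strict Implicit.
Unset Printing Implicit Defensive.

Import GRing.Theory.
Local Open Scope ring_scope.
Local Open Scope quotient_scope.

Lemma rmorphism_ext (A B : comPzRingType) (f g : {rmorphism A -> B}) :
  f =1 g -> f = g.
Proof.
case: f => f [[[f0 fD]] [[f1 fM]]]; case: g => g [[[g0 gD]] [[g1 gM]]] /=.
move=> /funext e; subst g.
by rewrite (Prop_irrelevance g0 f0) (Prop_irrelevance gD fD)
  (Prop_irrelevance g1 f1) (Prop_irrelevance gM fM).
Qed.

Section WittCarry.
Variable p : nat.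
Implicit Type A : comPzRingType.

(* The integral polynomial ((x + y)^p - x^p - y^p) / p, for p prime. *)
Definition witt_carry A (x y : A) : A :=
  \sum_(1 <= i < p) (x ^+ i * y ^+ (p - i)) *+ ('C(p, i) %/ p).

Lemma rmorph_carry A (B : comPzRingType) (f : {rmorphism A -> B}) x y :
  f (witt_carry x y) = witt_carry (f x) (f y).
Proof.
rewrite rmorph_sum; apply: eq_bigr => i _.
by rewrite rmorphMn rmorphM !rmorphXn.
Qed.

Hypothesis pP : prime p.

Lemma exprD_carry A (x y : A) :
  (x + y) ^+ p = x ^+ p + y ^+ p + witt_carry x y *+ p.
Proof.
have p0 := prime_gt0 pP.
have -> : (x + y) ^+ p = \sum_(0 <= i < p.+1) (x ^+ i * y ^+ (p - i)) *+ 'C(p, i).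
  by rewrite big_mkord addrC exprDn; apply: eq_bigr => i _; rewrite mulrC.
rewrite big_nat_recr //= big_ltn // bin0 binn subn0 subnn !expr0.
rewrite mulr1 mul1r !mulr1n addrC addrA; congr (_ + _).
rewrite /witt_carry -sumrMnl; apply: eq_big_nat => i ip.
by rewrite -mulrnA divnK // prime_dvd_bin.
Qed.

Lemma carryC A (x y : A) : witt_carry x y = witt_carry y x.
Proof.
rewrite /witt_carry big_nat_rev; apply: eq_big_nat => i /andP[i1 ip].
rewrite add1n subSS subKn 1?ltnW // bin_sub 1?ltnW //.
by rewrite mulrC.
Qed.

Lemma carry0 A (x : A) : witt_carry 0 x = 0.
Proof.
rewrite /witt_carry big_nat big1 // => i /andP[i1 _].
by rewrite expr0n -[i]prednK //= mul0r mul0rn.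
Qed.

Lemma carryM A (a x y : A) : witt_carry (a * x) (a * y) = a ^+ p * witt_carry x y.
Proof.
rewrite /witt_carry big_distrr; apply: eq_big_nat => i /andP[_ ip].
rewrite /= !exprMn mulrACA -exprD subnKC 1?ltnW //.
by rewrite mulrnAr.
Qed.

End WittCarry.

Lemma carryA_torsionfree p (A : comPzRingType) (x y z : A) : prime p ->
  injective (fun u : A => u *+ p) ->
  witt_carry p x y + witt_carry p (x + y) z
  = witt_carry p y z + witt_carry p x (y + z).
Proof.
move=> pP; apply; rewrite !mulrnDl; apply: (addrI (x ^+ p + y ^+ p + z ^+ p)).
transitivity ((x + y + z) ^+ p).
  by rewrite (exprD_carry pP (x + y)) (exprD_carry pP x) addrACA -(addrA _ (z ^+ p)).
by rewrite -(addrA x) (exprD_carry pP x) (exprD_carry pP y) !addrA.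
Qed.

Lemma carryA_image p (P A : comPzRingType) (m : {rmorphism P -> A}) (a b c : P) :
  prime p -> injective (fun u : P => u *+ p) ->
  witt_carry p (m a) (m b) + witt_carry p (m a + m b) (m c)
  = witt_carry p (m b) (m c) + witt_carry p (m a) (m b + m c).
Proof.
move=> pP inj; rewrite -!rmorphD -!rmorph_carry -!rmorphD.
by rewrite carryA_torsionfree.
Qed.

Lemma mpoly_int_torsionfree n p : (0 < p)%N ->
  injective (fun u : {mpoly int[n]} => u *+ p).
Proof.
move=> p0 u w /= /mpolyP e; apply/mpolyP => k.
by have := e k; rewrite !mcoeffMn => /(Num.Theory.pmulrnI p0).
Qed.

Lemma carryA p (A : comNzRingType) (x y z : A) : prime p ->
  witt_carry p x y + witt_carry p (x + y) z
  = witt_carry p y z + witt_carry p x (y + z).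
Proof.
move=> pP.
pose v (i : 'I_3) : A := nth 0 [:: x; y; z] i.
pose m : {rmorphism {mpoly int[3]} -> A} := mmap (intmul (1 : A)) v.
have mE i : m 'X_i = v i by rewrite /m /= mmapX mmap1U.
have mX : m 'X_(inord 0) = x by rewrite mE /v inordK.
have mY : m 'X_(inord 1) = y by rewrite mE /v inordK.
have mZ : m 'X_(inord 2) = z by rewrite mE /v inordK.
rewrite -mX -mY -mZ; apply: carryA_image => //.
exact: mpoly_int_torsionfree (prime_gt0 pP).
Qed.

(* Length-two Witt vectors of a ring of characteristic p, in Witt coordinates.
   The term p a_1 b_1 of the general product formula vanishes here. *)
Section Witt2.
Variables (p : nat) (R : comNzRingType).

Record witt2 (chR : p \in [pchar R]) := Witt2 { witt_c0 : R; witt_c1 : R }.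
Variable chR : p \in [pchar R].
Local Notation W := (witt2 chR).
Local Notation mkW := (@Witt2 chR).
Let pP : prime p := pcharf_prime chR.

Definition witt2_pair (u : W) := (witt_c0 u, witt_c1 u).
Definition pair_witt2 (u : R * R) : W := mkW u.1 u.2.
Lemma witt2_pairK : cancel witt2_pair pair_witt2. Proof. by case. Qed.
HB.instance Definition _ := Choice.copy W (can_type witt2_pairK).

Definition witt2_add (u v : W) : W :=
  mkW (witt_c0 u + witt_c0 v)
      (witt_c1 u + witt_c1 v - witt_carry p (witt_c0 u) (witt_c0 v)).
Definition witt2_opp (u : W) : W :=
  mkW (- witt_c0 u) (- witt_c1 u + witt_carry p (witt_c0 u) (- witt_c0 u)).
Definition witt2_mul (u v : W) : W :=
  mkW (witt_c0 u * witt_c0 v)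
      (witt_c0 u ^+ p * witt_c1 v + witt_c0 v ^+ p * witt_c1 u).

Lemma witt2_addC : commutative witt2_add.
Proof.
by move=> [a b] [c d]; rewrite /witt2_add /= (addrC a) (addrC b) carryC.
Qed.

Lemma witt2_addA : associative witt2_add.
Proof.
move=> [a b] [c d] [e f]; rewrite /witt2_add /= addrA; congr Witt2.
have h := carryA a c e pP.
by rewrite !addrA -[LHS]addrA -opprD -h opprD addrA [b + d - _ + f]addrAC.
Qed.

Lemma witt2_add0 : left_id (mkW 0 0) witt2_add.
Proof. by move=> [a b]; rewrite /witt2_add /= carry0 !add0r subr0. Qed.

Lemma witt2_addN : left_inverse (mkW 0 0) witt2_opp witt2_add.
Proof.
move=> [a b]; rewrite /witt2_add /= addNr; congr Witt2.
by rewrite (carryC _ (- a) a) (addrC (- b)) addrNK subrr.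
Qed.

HB.instance Definition _ :=
  GRing.isZmodule.Build W witt2_addA witt2_addC witt2_add0 witt2_addN.

Lemma witt2_mulC : commutative witt2_mul.
Proof.
by move=> [a b] [c d]; rewrite /witt2_mul /= (mulrC a) (addrC (a ^+ p * d)).
Qed.

Lemma witt2_mulA : associative witt2_mul.
Proof.
move=> [a b] [c d] [e f]; rewrite /witt2_mul /= mulrA; congr Witt2.
by rewrite !exprMn !mulrDr !mulrA addrA (mulrC (e ^+ p) (a ^+ p)) (mulrC (c ^+ p) (e ^+ p)).
Qed.

Lemma witt2_mul1 : left_id (mkW 1 0) witt2_mul.
Proof. by move=> [a b]; rewrite /witt2_mul /= expr1n !mul1r mulr0 addr0. Qed.

Lemma exprD_pchar (x y : R) : (x + y) ^+ p = x ^+ p + y ^+ p.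
Proof. by rewrite exprD_carry // mulrn_pchar // addr0. Qed.

Lemma witt2_mulD : left_distributive witt2_mul witt2_add.
Proof.
move=> [a b] [c d] [e f]; rewrite /witt2_mul /witt2_add /= mulrDl; congr Witt2.
rewrite exprD_pchar mulrDl [a * e]mulrC [c * e]mulrC carryM.
by rewrite mulrBr mulrDr [LHS]addrA addrACA.
Qed.

HB.instance Definition _ :=
  GRing.Zmodule_isComPzRing.Build W witt2_mulA witt2_mulC witt2_mul1 witt2_mulD.

Lemma witt2_residue_is_nmod : nmod_morphism (@witt_c0 chR).
Proof. by []. Qed.
Lemma witt2_residue_is_monoid : monoid_morphism (@witt_c0 chR).
Proof. by []. Qed.
HB.instance Definition _ := GRing.isNmodMorphism.Build W R (@witt_c0 chR)
  witt2_residue_is_nmod.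
HB.instance Definition _ := GRing.isMonoidMorphism.Build W R (@witt_c0 chR)
  witt2_residue_is_monoid.

Definition witt2_Frobenius (u : W) : W := mkW (witt_c0 u ^+ p) (witt_c1 u ^+ p).

End Witt2.

Section Witt2Frobenius.
Variables (p : nat) (R : comNzRingType) (chR : p \in [pchar R]).
Let pP : prime p := pcharf_prime chR.

Lemma witt2_Frobenius_is_nmod : nmod_morphism (@witt2_Frobenius p R chR).
Proof.
have p0 := prime_gt0 pP.
split; first by congr Witt2; rewrite expr0n gtn_eqF.
move=> [a b] [c d]; congr Witt2 => /=; first exact: exprD_pchar.
by rewrite -!(pFrobenius_autE chR) rmorphB rmorphD rmorph_carry.
Qed.

Lemma witt2_Frobenius_is_monoid : monoid_morphism (@witt2_Frobenius p R chR).
Proof.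
have p0 := prime_gt0 pP.
split; first by congr Witt2 => /=; rewrite ?expr1n // expr0n gtn_eqF.
move=> [a b] [c d]; congr Witt2 => /=; first exact: exprMn.
by rewrite exprD_pchar // !exprMn.
Qed.

HB.instance Definition _ := GRing.isNmodMorphism.Build
  (witt2 chR) (witt2 chR) (@witt2_Frobenius p R chR) witt2_Frobenius_is_nmod.
HB.instance Definition _ := GRing.isMonoidMorphism.Build
  (witt2 chR) (witt2 chR) (@witt2_Frobenius p R chR) witt2_Frobenius_is_monoid.
End Witt2Frobenius.

(* ring_quotient only provides the ring structure of quotients by proper ideals;
   here the ideal is arbitrary and the quotient may be the zero ring. *)
Section QuotientRing.
Variables (A : comPzRingType) (s : seq A).

Definition gen_ideal (x : A) : Prop :=
  exists c : 'I_(size s) -> A, x = \sum_(i < size s) c i * s`_i.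
Definition gen_ideal_pred : {pred A} := fun x => `[< gen_ideal x >].

Lemma gen_ideal_zmod_closed : zmod_closed gen_ideal_pred.
Proof.
split; first by apply/asboolP; exists (fun=> 0); rewrite big1 // => i _; rewrite mul0r.
move=> x y /asboolP[c ->] /asboolP[d ->]; apply/asboolP.
exists (fun i => c i - d i); rewrite -sumrB.
by apply: eq_bigr => i _; rewrite mulrBl.
Qed.
HB.instance Definition _ :=
  GRing.isZmodClosed.Build A gen_ideal_pred gen_ideal_zmod_closed.

Lemma gen_idealMl a x : x \in gen_ideal_pred -> a * x \in gen_ideal_pred.
Proof.
move=> /asboolP[c ->]; apply/asboolP; exists (fun i => a * c i).
by rewrite big_distrr; apply: eq_bigr => i _ /=; rewrite mulrA.
Qed.

Definition quotient_ring : Type := Quotient.quot gen_ideal_pred.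
HB.instance Definition _ := GRing.Zmodule.on quotient_ring.

Definition to_quotient (x : A) : quotient_ring := \pi_(Quotient.quot gen_ideal_pred) x.
Definition from_quotient (x : quotient_ring) : A := repr (x : Quotient.quot gen_ideal_pred).

Lemma from_quotientK : cancel from_quotient to_quotient.
Proof. exact: reprK. Qed.

Lemma to_quotient_eqP x y :
  reflect (to_quotient x = to_quotient y) (x - y \in gen_ideal_pred).
Proof. by rewrite Quotient.idealrBE; apply: eqP. Qed.

Lemma to_quotient_is_nmod : nmod_morphism to_quotient.
Proof.
split; first by rewrite /to_quotient piE.
by move=> x y; rewrite /to_quotient piE.
Qed.
HB.instance Definition _ :=
  GRing.isNmodMorphism.Build A quotient_ring to_quotient to_quotient_is_nmod.

Definition quotient_one : quotient_ring := to_quotient 1.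
Definition quotient_mul (x y : quotient_ring) : quotient_ring :=
  to_quotient (from_quotient x * from_quotient y).

Lemma to_quotientM x y :
  to_quotient (x * y) = quotient_mul (to_quotient x) (to_quotient y).
Proof.
have h z : z - from_quotient (to_quotient z) \in gen_ideal_pred.
  by apply/to_quotient_eqP; rewrite from_quotientK.
apply/to_quotient_eqP; set x' := from_quotient _; set y' := from_quotient _.
have -> : x * y - x' * y' = y * (x - x') + x' * (y - y').
  by rewrite !mulrBr addrA (mulrC y) (mulrC y) subrK.
by rewrite rpredD // gen_idealMl.
Qed.

Lemma quotient_mulA : associative quotient_mul.
Proof.
move=> x y z; rewrite -(from_quotientK x) -(from_quotientK y) -(from_quotientK z).
by rewrite -!to_quotientM mulrA.
Qed.
Lemma quotient_mulC : commutative quotient_mul.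
Proof. by move=> x y; rewrite /quotient_mul mulrC. Qed.
Lemma quotient_mul1 : left_id quotient_one quotient_mul.
Proof. by move=> x; rewrite -(from_quotientK x) -to_quotientM mul1r. Qed.
Lemma quotient_mulD : left_distributive quotient_mul +%R.
Proof.
move=> x y z; rewrite -(from_quotientK x) -(from_quotientK y) -(from_quotientK z).
by rewrite -raddfD -!to_quotientM mulrDl raddfD.
Qed.
HB.instance Definition _ := GRing.Zmodule_isComPzRing.Build quotient_ring
  quotient_mulA quotient_mulC quotient_mul1 quotient_mulD.

Lemma to_quotient_is_monoid : monoid_morphism to_quotient.
Proof. by split => // x y; apply: to_quotientM. Qed.
HB.instance Definition _ :=
  GRing.isMonoidMorphism.Build A quotient_ring to_quotient to_quotient_is_monoid.
End QuotientRing.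

Section FrobeniusHom.
Variables (p : nat) (pP : prime p) (A : comPzRingType) (pA : p%:R = 0 :> A).

Definition Frobenius_hom of prime p & p%:R = 0 :> A := fun x : A => x ^+ p.
Local Notation F := (Frobenius_hom pP pA).

Lemma Frobenius_hom_is_nmod : nmod_morphism F.
Proof.
split; first by rewrite /Frobenius_hom expr0n gtn_eqF ?prime_gt0.
by move=> x y; rewrite /Frobenius_hom exprD_carry // -[_ *+ p]mulr_natr pA mulr0 addr0.
Qed.
Lemma Frobenius_hom_is_monoid : monoid_morphism F.
Proof. by split=> [|x y]; rewrite /Frobenius_hom ?expr1n ?exprMn. Qed.
HB.instance Definition _ := GRing.isNmodMorphism.Build A A F Frobenius_hom_is_nmod.
HB.instance Definition _ := GRing.isMonoidMorphism.Build A A F Frobenius_hom_is_monoid.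
End FrobeniusHom.

(* Schemes are taken as functors of points (Demazure-Gabriel): covariant set-valued
   functors on commutative rings that are Zariski sheaves and are covered by open
   affine subfunctors.  A k-scheme is a scheme with a morphism to Spec k. *)
Record zfunctor := ZFunctor {
  points :> comPzRingType -> Type;
  pmap : forall A B : comPzRingType, {rmorphism A -> B} -> points A -> points B;
  pmap_id : forall (A : comPzRingType) (x : points A), pmap idfun x = x;
  pmap_comp : forall (A B C : comPzRingType)
    (g : {rmorphism B -> C}) (f : {rmorphism A -> B}) (x : points A),
    pmap (g \o f) x = pmap g (pmap f x)
}.
Arguments pmap X [A B] f x : rename.

Record zmorphism (X Y : zfunctor) := ZMorphism {
  zmap :> forall A : comPzRingType, X A -> Y A;
  zmap_nat : forall (A B : comPzRingType) (f : {rmorphism A -> B}) (x : X A),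
    zmap (pmap X f x) = pmap Y f (zmap x)
}.
Arguments zmap {X Y} u [A] x : rename.

Section Spec.
Variable A : comPzRingType.

Lemma Spec_id (B : comPzRingType) (x : {rmorphism A -> B}) : idfun \o x = x :> {rmorphism A -> B}.
Proof. exact: rmorphism_ext. Qed.
Lemma Spec_comp (B C D : comPzRingType) (g : {rmorphism C -> D})
  (f : {rmorphism B -> C}) (x : {rmorphism A -> B}) :
  (g \o f) \o x = g \o (f \o x) :> {rmorphism A -> D}.
Proof. exact: rmorphism_ext. Qed.

Definition Spec : zfunctor :=
  @ZFunctor (fun B => {rmorphism A -> B}) (fun B C f x => f \o x) Spec_id Spec_comp.

(* By Yoneda, a morphism out of Spec A is a point over A. *)
Definition Spec_point X (u : zmorphism Spec X) : X A := u A (idfun : {rmorphism A -> A}).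
End Spec.

Section SpecMap.
Variables (A B : comPzRingType) (f : {rmorphism A -> B}).
Lemma Spec_map_nat (C D : comPzRingType) (g : {rmorphism C -> D}) (x : Spec B C) :
  (g \o x) \o f = g \o (x \o f) :> {rmorphism A -> D}.
Proof. exact: rmorphism_ext. Qed.
Definition Spec_map : zmorphism (Spec B) (Spec A) :=
  @ZMorphism (Spec B) (Spec A) (fun C (x : {rmorphism B -> C}) => x \o f) Spec_map_nat.
End SpecMap.

Definition is_localization (A B : comPzRingType) (f : A) (phi : {rmorphism A -> B}) :=
  [/\ exists g, phi f * g = 1,
      forall b, exists a n, b * phi f ^+ n = phi a
    & forall a, phi a = 0 -> exists n, f ^+ n * a = 0].

Definition zariski_sheaf (X : zfunctor) :=
  forall (A : comPzRingType) (n : nat) (f : 'I_n -> A) (B : 'I_n -> comPzRingType)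
    (phi : forall i, {rmorphism A -> B i}),
  (exists r : 'I_n -> A, \sum_i r i * f i = 1) ->
  (forall i, is_localization (f i) (phi i)) ->
  forall x : forall i, X (B i),
  (forall i j (C : comPzRingType) (g : {rmorphism B i -> C}) (h : {rmorphism B j -> C}),
     g \o phi i =1 h \o phi j -> pmap X g (x i) = pmap X h (x j)) ->
  exists! y : X A, forall i, pmap X (phi i) y = x i.

Definition monomorphism U X (u : zmorphism U X) :=
  forall A, injective (@zmap U X u A).

Definition is_image U X (u : zmorphism U X) A (x : X A) := exists y, u A y = x.

(* The pullback along a point x : Spec A -> X is the open subfunctor D(J) of Spec A. *)
Definition open_immersion U X (u : zmorphism U X) :=
  monomorphism u /\
  forall (A : comPzRingType) (x : X A), exists J : A -> Prop,
  forall (B : comPzRingType) (phi : {rmorphism A -> B}),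
    is_image u (pmap X phi x) <->
    exists n (a : 'I_n -> A) (b : 'I_n -> B),
      (forall i, J (a i)) /\ \sum_i b i * phi (a i) = 1.

(* The pullback along a point x : Spec A -> X is the closed subfunctor V(J) of Spec A. *)
Definition closed_immersion Z X (i : zmorphism Z X) :=
  monomorphism i /\
  forall (A : comPzRingType) (x : X A), exists J : A -> Prop,
  forall (B : comPzRingType) (phi : {rmorphism A -> B}),
    is_image i (pmap X phi x) <-> (forall a, J a -> phi a = 0).

(* Fields detect whether open subfunctors cover X. *)
Definition is_scheme (X : zfunctor) :=
  zariski_sheaf X /\
  exists (I : Type) (B : I -> comPzRingType) (u : forall i, zmorphism (Spec (B i)) X),
    (forall i, open_immersion (u i)) /\
    (forall (K : fieldType) (x : X K), exists i, is_image (u i) x).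

Section Flat.
Variables (L B : comPzRingType) (s : {rmorphism L -> B}).

Definition balanced (M : lmodType L) (T : zmodType) (t : M -> B -> T) :=
  [/\ forall m m' b, t (m + m') b = t m b + t m' b,
      forall m b b', t m (b + b') = t m b + t m b'
    & forall r m b, t (r *: m) b = t m (s r * b)].

Definition is_tensor (M : lmodType L) (T : zmodType) (t : M -> B -> T) :=
  balanced t /\
  forall (G : zmodType) (t' : M -> B -> G), balanced t' ->
    exists2 h : {additive T -> G}, (forall m b, h (t m b) = t' m b)
    & forall h' : {additive T -> G}, (forall m b, h' (t m b) = t' m b) -> h' =1 h.

(* M |-> M (x) B preserves injections; tensor products are given by their universal
   property. *)
Definition flat_hom :=
  forall (M N : lmodType L) (j : {linear M -> N}), injective j ->
  forall (S T : zmodType) (tM : M -> B -> S) (tN : N -> B -> T),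
  is_tensor tM -> is_tensor tN ->
  forall h : {additive S -> T}, (forall m b, h (tM m b) = tN (j m) b) ->
  injective h.
End Flat.

(* Flatness over an affine base, tested on all affine opens of the source. *)
Definition flat (L : comPzRingType) (X : zfunctor) (s : zmorphism X (Spec L)) :=
  forall (B : comPzRingType) (u : zmorphism (Spec B) X), open_immersion u ->
  flat_hom (s B (Spec_point u)).

Definition is_pullback P X Y Z (px : zmorphism P X) (py : zmorphism P Y)
    (f : zmorphism X Z) (g : zmorphism Y Z) :=
  (forall A (w : P A), f A (px A w) = g A (py A w)) /\
  (forall A (x : X A) (y : Y A), f A x = g A y ->
     exists! w : P A, px A w = x /\ py A w = y).

Section FLift.
Variables (p : nat) (k : fieldType) (chk : p \in [pchar k]).

(* On points over A the absolute Frobenius of X is induced by that of A, which has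
   characteristic p as soon as X has a point over A. *)
Section AbsoluteFrobenius.
Variables (X : zfunctor) (s : zmorphism X (Spec k)).

Lemma point_char (A : comPzRingType) (x : X A) : p%:R = 0 :> A.
Proof.
by have [_ /eqP e] := andP chk; rewrite -(rmorph_nat (s A x)) e rmorph0.
Qed.

Definition absolute_Frobenius_map A (x : X A) : X A :=
  pmap X (Frobenius_hom (pcharf_prime chk) (point_char x)) x.

Lemma absolute_Frobenius_nat (A B : comPzRingType) (f : {rmorphism A -> B}) (x : X A) :
  absolute_Frobenius_map (pmap X f x) = pmap X f (absolute_Frobenius_map x).
Proof.
rewrite /absolute_Frobenius_map -!pmap_comp; congr pmap; apply: rmorphism_ext => a /=.
by rewrite /Frobenius_hom rmorphXn.
Qed.

Definition absolute_Frobenius : zmorphism X X := ZMorphism absolute_Frobenius_nat.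
End AbsoluteFrobenius.

(* witt_c0 is the projection W_2(k) -> k. *)
Definition F_liftable (X : zfunctor) (s : zmorphism X (Spec k)) : Prop :=
  exists (X' : zfunctor) (s' : zmorphism X' (Spec (witt2 chk)))
         (i : zmorphism X X') (F' : zmorphism X' X'),
  [/\ is_scheme X',
      flat s',
      closed_immersion i,
      is_pullback i s s' (Spec_map (@witt_c0 p k chk))
    & (forall A (y : X' A), s' A (F' A y) = Spec_map (@witt2_Frobenius p k chk) A (s' A y)) /\
      (forall A (x : X A), F' A (i A x) = i A (absolute_Frobenius s A x))].
End FLift.

Definition Spec_quotient_structure n (k : fieldType) (I : seq {mpoly k[n]}) :
    zmorphism (Spec (quotient_ring I)) (Spec k) :=
  Spec_map (@to_quotient _ I \o @mpolyC n k).

(* Main.v *)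
From HB Require Import structures.
Require Import Defs.
From mathcomp Require Import all_boot all_order all_algebra.
From mathcomp Require Import generic_quotient ring_quotient.
From mathcomp Require Import boolp.
From mathcomp Require classical_sets.
From mathcomp Require Import mpoly.
From mathcomp Require Import ring zify.

Set Implicit Arguments.
Unset Strict Implicit.
Unset Printing Implicit Defensive.

Import GRing.Theory.
Local Open Scope ring_scope.

(* Write an affine variety as V(f_1, ..., f_m) in affine space over k, and let phi be the
   lift of Frobenius to W_2(k)[x_1, ..., x_n] with phi(x_i) = x_i^2 + 2 D_i.  For any lift F
   of f one has phi(F) = F^2 + 2 d with d reducing to
     e_2(monomials of f) + sum_i (df/dx_i)^2 D_i + u^2,
   where u comes from adding 2 u to the Teichmuller lift of f.  If the f_j form a regular
   sequence, the quotient by the lifts F_j is flat over W_2(k), and phi descends to it as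
   soon as every d lies in (f_1, ..., f_m).  So both cases reduce to solving these
   membership conditions for the D_i and u, which depends only on parities of exponents.

   In case (1), with p = x^(a-2), q = y^(b-2), r = z^(c-2), one must reach
   qr(yz)^2 + pr(xz)^2 + pq(xy)^2: an even exponent a gives the generator
   (yz)^2, an odd one the congruence (yz)^2 = (px)^2.  In case (2) one must reach
   pq(zw)^2 in the first equation and rs(xy)^2 in the second: squaring g = 0 turns (zw)^2
   into multiples of x^2 and y^2, which are available in the first equation at the price of
   an error term in the second, and conversely; after two steps the error vanishes. *)

(** * Localization *)

(** Identities between fractions are polynomial in the powers of [f] whatever the exponents, so
    powers with a variable exponent become atoms before [ring]. *)
Ltac pow_ring :=
  repeat match goal with |- context [?x ^+ ?n] => 
    is_var n; let y := fresh in set y := x ^+ n; clearbody y end;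
  intros; ring.

(** The closure proofs are parameters, so that a function constructed inside a proof gets its
    morphism structure canonically. *)
Definition mk_rmorphism (A B : comPzRingType) (f : A -> B)
  of nmod_morphism f & monoid_morphism f : A -> B := f.
HB.instance Definition _ (A B : comPzRingType) (f : A -> B)
    (fD : nmod_morphism f) (fM : monoid_morphism f) :=
  GRing.isNmodMorphism.Build A B (mk_rmorphism fD fM) fD.
HB.instance Definition _ (A B : comPzRingType) (f : A -> B)
    (fD : nmod_morphism f) (fM : monoid_morphism f) :=
  GRing.isMonoidMorphism.Build A B (mk_rmorphism fD fM) fM.

Lemma rmorphism_factor (A B C : comPzRingType) (q : {rmorphism A -> B})
    (g : {rmorphism A -> C}) :
  (forall b, exists a, q a = b) -> (forall a, q a = 0 -> g a = 0) ->
  exists h : {rmorphism B -> C}, forall a, h (q a) = g a.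
Proof.
move=> /choice[r rK] kerg; pose h b := g (r b).
have hq a : h (q a) = g a.
  by apply/eqP; rewrite -subr_eq0 -rmorphB kerg // rmorphB rK subrr.
have hN : nmod_morphism h.
  split=> [|x y]; first by rewrite -(rmorph0 q) hq rmorph0.
  by rewrite -[in LHS](rK x) -[in LHS](rK y) -rmorphD hq rmorphD.
have hM : monoid_morphism h.
  split=> [|x y]; first by rewrite -(rmorph1 q) hq rmorph1.
  by rewrite -[in LHS](rK x) -[in LHS](rK y) -rmorphM hq rmorphM.
by exists (mk_rmorphism hN hM).
Qed.

Lemma to_quotient_surj (A : comPzRingType) (s : seq A) (b : quotient_ring s) :
  exists a, to_quotient s a = b.
Proof. by exists (from_quotient b); rewrite from_quotientK. Qed.

Lemma to_quotient_eq0 (A : comPzRingType) (s : seq A) (a : A) :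
  to_quotient s a = 0 <-> gen_ideal s a.
Proof.
rewrite -(rmorph0 (to_quotient s)); split.
  by move=> /to_quotient_eqP; rewrite subr0 => /asboolP.
by move=> h; apply/to_quotient_eqP; rewrite subr0; apply/asboolP.
Qed.

Section Localization.
Variables (A : comPzRingType) (f : A).

(** A pair (a, n) stands for a / f^n. The factor f^k keeps the relation transitive when [f] is a
    zero divisor. *)
Definition loc_rel (u v : A * nat) : bool :=
  `[< exists k, f ^+ k * (u.1 * f ^+ v.2) = f ^+ k * (v.1 * f ^+ u.2) >].

Lemma loc_rel_refl : reflexive loc_rel.
Proof. by move=> u; apply/asboolP; exists 0. Qed.

Lemma loc_rel_sym : ssrbool.symmetric loc_rel.
Proof. by move=> u v; apply/asboolP/asboolP => -[k e]; exists k. Qed.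

Lemma loc_rel_trans : transitive loc_rel.
Proof.
move=> [b m] [a n] [c r] /asboolP[k /= e] /asboolP[l /= e'].
apply/asboolP; exists (k + l + m)%N; rewrite /= !exprD.
have -> : f ^+ k * f ^+ l * f ^+ m * (a * f ^+ r)
        = f ^+ l * f ^+ r * (f ^+ k * (a * f ^+ m)) by pow_ring.
have -> : f ^+ k * f ^+ l * f ^+ m * (c * f ^+ n)
        = f ^+ k * f ^+ n * (f ^+ l * (c * f ^+ m)) by pow_ring.
by rewrite e -e'; pow_ring.
Qed.

Canonical loc_equiv := EquivRel loc_rel loc_rel_refl loc_rel_sym loc_rel_trans.
Definition localization : Type := {eq_quot loc_equiv}%qT.
HB.instance Definition _ := Choice.on localization.
HB.instance Definition _ := Quotient.on localization.

Definition frac (a : A) (n : nat) : localization :=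
  (\pi_{eq_quot loc_equiv} (a, n))%qT.
Definition frac_num (u : localization) : A := (repr (u : {eq_quot loc_equiv}%qT)).1.
Definition frac_exp (u : localization) : nat := (repr (u : {eq_quot loc_equiv}%qT)).2.

Lemma fracK u : frac (frac_num u) (frac_exp u) = u.
Proof. by rewrite /frac /frac_num /frac_exp -surjective_pairing reprK. Qed.

Lemma frac_eqP a n b m :
  frac a n = frac b m <->
  exists k, f ^+ k * (a * f ^+ m) = f ^+ k * (b * f ^+ n).
Proof.
split; first by move/eqmodP/asboolP.
by move=> h; apply/eqmodP/asboolP.
Qed.

Lemma frac_scale a n k : frac (a * f ^+ k) (n + k) = frac a n.
Proof. by apply/frac_eqP; exists 0; rewrite exprD; ring. Qed.

Definition loc_add (u v : localization) : localization :=
  frac (frac_num u * f ^+ frac_exp v + frac_num v * f ^+ frac_exp u)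
       (frac_exp u + frac_exp v).
Definition loc_opp (u : localization) : localization :=
  frac (- frac_num u) (frac_exp u).
Definition loc_mul (u v : localization) : localization :=
  frac (frac_num u * frac_num v) (frac_exp u + frac_exp v).

Lemma loc_addE a n b m :
  loc_add (frac a n) (frac b m) = frac (a * f ^+ m + b * f ^+ n) (n + m).
Proof.
have [k e] := (frac_eqP _ _ _ _).1 (fracK (frac a n)).
have [l e'] := (frac_eqP _ _ _ _).1 (fracK (frac b m)).
rewrite /loc_add; set a' := frac_num _ in e *; set n' := frac_exp _ in e *.
set b' := frac_num _ in e' *; set m' := frac_exp _ in e' *.
apply/frac_eqP; exists (k + l)%N; rewrite !exprD.
transitivity ((f ^+ k * (a' * f ^+ n)) * (f ^+ l * f ^+ m * f ^+ m')
  + (f ^+ l * (b' * f ^+ m)) * (f ^+ k * f ^+ n * f ^+ n')); first by pow_ring.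
by rewrite e e'; pow_ring.
Qed.

Lemma loc_mulE a n b m : loc_mul (frac a n) (frac b m) = frac (a * b) (n + m).
Proof.
have [k e] := (frac_eqP _ _ _ _).1 (fracK (frac a n)).
have [l e'] := (frac_eqP _ _ _ _).1 (fracK (frac b m)).
rewrite /loc_mul; set a' := frac_num _ in e *; set n' := frac_exp _ in e *.
set b' := frac_num _ in e' *; set m' := frac_exp _ in e' *.
apply/frac_eqP; exists (k + l)%N; rewrite !exprD.
transitivity ((f ^+ k * (a' * f ^+ n)) * (f ^+ l * (b' * f ^+ m))); first by pow_ring.
by rewrite e e'; pow_ring.
Qed.

Lemma loc_addA : associative loc_add.
Proof.
move=> u v w; rewrite -(fracK u) -(fracK v) -(fracK w) !loc_addE addnA.
congr frac; rewrite !exprD.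
move: (f ^+ frac_exp u) (f ^+ frac_exp v) (f ^+ frac_exp w); pow_ring.
Qed.
Lemma loc_addC : commutative loc_add.
Proof.
by move=> u v; rewrite -(fracK u) -(fracK v) !loc_addE addrC addnC.
Qed.
Lemma loc_add0 : left_id (frac 0 0) loc_add.
Proof. by move=> u; rewrite -(fracK u) loc_addE mul0r add0r mulr1. Qed.
Lemma loc_addN : left_inverse (frac 0 0) loc_opp loc_add.
Proof.
move=> u; rewrite -[in X in loc_add _ X](fracK u) loc_addE.
by rewrite mulNr addNr; apply/frac_eqP; exists 0%N; rewrite !mul0r.
Qed.
HB.instance Definition _ :=
  GRing.isZmodule.Build localization loc_addA loc_addC loc_add0 loc_addN.

Lemma loc_mulA : associative loc_mul.
Proof.
by move=> u v w; rewrite -(fracK u) -(fracK v) -(fracK w) !loc_mulE addnA mulrA.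
Qed.
Lemma loc_mulC : commutative loc_mul.
Proof. by move=> u v; rewrite -(fracK u) -(fracK v) !loc_mulE mulrC addnC. Qed.
Lemma loc_mul1 : left_id (frac 1 0) loc_mul.
Proof. by move=> u; rewrite -(fracK u) loc_mulE mul1r. Qed.
Lemma loc_mulD : left_distributive loc_mul loc_add.
Proof.
move=> u v w; rewrite -(fracK u) -(fracK v) -(fracK w) !(loc_addE, loc_mulE).
set n := frac_exp u; set m := frac_exp v; set r := frac_exp w.
rewrite -[in LHS](frac_scale _ _ r) (_ : (n + m + r + r = n + r + (m + r))%N).
  by congr frac; rewrite !exprD; move: (frac_num _) (frac_num _) (frac_num _); pow_ring.
by rewrite addnACA addnA.
Qed.
HB.instance Definition _ := GRing.Zmodule_isComPzRing.Build localization
  loc_mulA loc_mulC loc_mul1 loc_mulD.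

Definition to_loc (a : A) : localization := frac a 0.

Lemma to_loc_is_nmod : nmod_morphism to_loc.
Proof.
by split=> // a b; rewrite [RHS]loc_addE !mulr1.
Qed.
Lemma to_loc_is_monoid : monoid_morphism to_loc.
Proof. by split=> // a b; rewrite [RHS]loc_mulE. Qed.
HB.instance Definition _ := GRing.isNmodMorphism.Build A localization to_loc to_loc_is_nmod.
HB.instance Definition _ := GRing.isMonoidMorphism.Build A localization to_loc to_loc_is_monoid.

Lemma to_locP : is_localization f to_loc.
Proof.
split.
- exists (frac 1 1); rewrite [LHS]loc_mulE mulr1.
  by apply/frac_eqP; exists 0%N; rewrite !mul1r mulr1.
- move=> b; exists (frac_num b), (frac_exp b).
  rewrite -[X in X * _](fracK b) -rmorphXn [LHS]loc_mulE.
  by apply/frac_eqP; exists 0%N; rewrite !mul1r addn0 mulr1.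
- move=> a /frac_eqP[k]; rewrite mul0r mulr0 mulr1 => e; by exists k.
Qed.

End Localization.

(** * Affine schemes as functors of points *)

(** The radical of the ideal [I] is again an ideal and contains every [f i], hence 1. *)
Lemma unit_ideal_powers (A : comPzRingType) n (r f : 'I_n -> A) (I : A -> Prop) :
  I 0 -> (forall x y, I x -> I y -> I (x + y)) -> (forall x y, I y -> I (x * y)) ->
  \sum_i r i * f i = 1 -> (forall i, exists N, I (f i ^+ N)) -> I 1.
Proof.
move=> I0 ID IM r1 fI; pose rad x := exists N, I (x ^+ N).
suff : rad 1 by move=> [N]; rewrite expr1n.
rewrite -r1; apply: (big_ind rad) => [|x y [m xm] [l yl]|i _].
- by exists 1%N.
(* Each term in the expansion of (x + y)^(m + l) has a factor x^m or y^l. *)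
- exists (m + l)%N; rewrite exprDn; apply: (big_ind I) => // i _.
  rewrite -mulr_natl; apply: (IM); have [il|/ltnW li] := leqP i l.
    by rewrite -addnBA // exprD -mulrA mulrC; apply: (IM).
  by rewrite -(subnK li) [y ^+ _]exprD mulrA; apply: (IM).
- by have [N fN] := fI i; exists N; rewrite exprMn; apply: (IM).
Qed.

Lemma localization_lift (A B C : comPzRingType) (f : A) (phi : {rmorphism A -> B})
    (psi : {rmorphism A -> C}) (u : C) :
  is_localization f phi -> psi f * u = 1 ->
  exists g : {rmorphism B -> C}, forall a, g (phi a) = psi a.
Proof.
move=> [[v fv] phi_frac kerphi] fu.
have fun_ n : psi f ^+ n * u ^+ n = 1 by rewrite -exprMn fu expr1n.
have /choice[an anP] : forall b, exists an : A * nat, b * phi f ^+ an.2 = phi an.1.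
  by move=> b; have [a [n e]] := phi_frac b; exists (a, n).
pose g b := psi (an b).1 * u ^+ (an b).2.
(* Every fraction representing [b] gives the same value: [u] cancels the power of [f] left by the
   equality of fractions. *)
have gE b a n : b * phi f ^+ n = phi a -> g b = psi a * u ^+ n.
  move=> e; have e' := anP b; rewrite /g; case: (an b) e' => a' m /= e'.
  have [k] : exists k, f ^+ k * (a * f ^+ m - a' * f ^+ n) = 0.
    by apply: kerphi; rewrite rmorphB !rmorphM !rmorphXn -e -e' mulrAC subrr.
  move=> /(congr1 psi); rewrite rmorph0 rmorphM rmorphB !rmorphM !rmorphXn => h.
  apply/eqP; rewrite eq_sym -subr_eq0.
  have <- : u ^+ k * u ^+ n * u ^+ m *
      (psi f ^+ k * (psi a * psi f ^+ m - psi a' * psi f ^+ n)) =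
      psi a * u ^+ n - psi a' * u ^+ m.
    transitivity (psi f ^+ k * u ^+ k *
      (psi a * u ^+ n * (psi f ^+ m * u ^+ m) -
       psi a' * u ^+ m * (psi f ^+ n * u ^+ n))); first by pow_ring.
    by rewrite !fun_ mul1r !mulr1.
  by rewrite h mulr0.
have gphi a : g (phi a) = psi a by rewrite (gE _ a 0) ?mulr1.
have gN : nmod_morphism g.
  split=> [|x y]; first by rewrite -(rmorph0 phi) gphi rmorph0.
  have [[a [n e]] [b [m e']]] := (phi_frac x, phi_frac y).
  rewrite (gE _ _ _ e) (gE _ _ _ e').
  rewrite (gE _ (a * f ^+ m + b * f ^+ n) (n + m)%N).
    rewrite rmorphD !rmorphM !rmorphXn exprD.
    transitivity (psi a * u ^+ n * (psi f ^+ m * u ^+ m) +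
       psi b * u ^+ m * (psi f ^+ n * u ^+ n)); first by pow_ring.
    by rewrite !fun_ !mulr1.
  by rewrite rmorphD !rmorphM !rmorphXn -e -e' exprD; pow_ring.
have gM : monoid_morphism g.
  split=> [|x y]; first by rewrite -(rmorph1 phi) gphi rmorph1.
  have [[a [n e]] [b [m e']]] := (phi_frac x, phi_frac y).
  rewrite (gE _ _ _ e) (gE _ _ _ e') (gE _ (a * b) (n + m)%N).
    by rewrite rmorphM exprD mulrACA.
  by rewrite rmorphM -e -e' exprD mulrACA.
by exists (mk_rmorphism gN gM).
Qed.

Section Cover.
Variables (A : comPzRingType) (n : nat) (f : 'I_n -> A) (B : 'I_n -> comPzRingType).
Variable phi : forall i, {rmorphism A -> B i}.
Hypothesis cover : exists r : 'I_n -> A, \sum_i r i * f i = 1.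
Hypothesis loc : forall i, is_localization (f i) (phi i).

(** The annihilator of a - a' is an ideal containing a power of each [f i]. *)
Lemma cover_separated a a' : (forall i, phi i a = phi i a') -> a = a'.
Proof.
move=> e; have [r r1] := cover; apply/eqP; rewrite -subr_eq0.
suff -> : a - a' = 1 * (a - a') by
  apply/eqP; apply: (@unit_ideal_powers A n r f (fun y => y * (a - a') = 0)) => //;
  [exact: mul0r | move=> x y ex ey; rewrite mulrDl ex ey addr0
  | move=> x y ey; rewrite -mulrA ey mulr0
  | move=> i; have [_ _ ker] := loc i; apply: ker; rewrite rmorphB e subrr].
by rewrite mul1r.
Qed.

Lemma cover_glue (b : forall i, B i) :
  (forall i j (C : comPzRingType) (g : {rmorphism B i -> C}) (h : {rmorphism B j -> C}),
     g \o phi i =1 h \o phi j -> g (b i) = h (b j)) ->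
  exists a, forall i, phi i a = b i.
Proof.
move=> compat.
have [N [a aE]] : exists N (a : 'I_n -> A), forall i, b i * phi i (f i) ^+ N = phi i (a i).
  have /choice[an anE] : forall i, exists an : A * nat, b i * phi i (f i) ^+ an.2 = phi i an.1.
    by move=> i; have [_ /(_ (b i))[a [m e]] _] := loc i; exists (a, m).
  pose N := (\max_i (an i).2)%N.
  exists N, (fun i => (an i).1 * f i ^+ (N - (an i).2)) => i.
  have le : ((an i).2 <= N)%N by apply: (leq_bigmax i).
  by rewrite -{1}(subnKC le) exprD mulrA anE rmorphM rmorphXn.
(* The fractions at i and j are compared in the localization at f_i f_j; one exponent [M] serves all
   pairs. *)
have [M ME] : exists M, forall i j,
    (f i * f j) ^+ M * (a i * f j ^+ N) = (f i * f j) ^+ M * (a j * f i ^+ N).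
  suff /choice[K KE] : forall ij : 'I_n * 'I_n, exists K,
      (f ij.1 * f ij.2) ^+ K * (a ij.1 * f ij.2 ^+ N) =
      (f ij.1 * f ij.2) ^+ K * (a ij.2 * f ij.1 ^+ N).
    exists (\max_ij K ij)%N => i j.
    have le : (K (i, j) <= \max_ij K ij)%N by apply: (leq_bigmax (i, j)).
    by rewrite -(subnK le) exprD -!mulrA; congr (_ * _); apply: (KE (i, j)).
  move=> [i j] /=; pose L := @to_loc A (f i * f j).
  have [[v fv] _ ker] := to_locP (f i * f j).
  have ui : L (f i) * (L (f j) * v) = 1 by rewrite mulrA -rmorphM.
  have uj : L (f j) * (L (f i) * v) = 1 by rewrite mulrCA ui.
  have [g gE] := localization_lift (loc i) ui.
  have [h hE] := localization_lift (loc j) uj.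
  have e : g (b i) = h (b j) by apply: compat => c /=; rewrite gE hE.
  have [|K KE] := ker (a i * f j ^+ N - a j * f i ^+ N).
    rewrite rmorphB !rmorphM !rmorphXn -gE -(hE (a j)) -!aE !rmorphM !rmorphXn.
    by rewrite gE hE e mulrAC subrr.
  by exists K; apply/eqP; rewrite -subr_eq0 -mulrBr KE.
(* With denominators [F i] and numerators [a' i] the cross products agree exactly, not just up to a
   power. *)
pose F i := f i ^+ (N + M); pose a' i := a i * f i ^+ M.
have bF i : b i * phi i (F i) = phi i (a' i).
  by rewrite rmorphXn exprD mulrA aE rmorphM rmorphXn.
have aF i j : a' i * F j = a' j * F i.
  have := ME i j; rewrite !exprMn /a' /F !exprD => e.
  transitivity (f i ^+ M * f j ^+ M * (a i * f j ^+ N)); first by pow_ring.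
  by rewrite e; pow_ring.
have [r r1] : exists r, 1 = \sum_i r i * F i.
  have [r0 r01] := cover.
  apply: (@unit_ideal_powers A n r0 f (fun y => exists r, y = \sum_i r i * F i)) => //.
  - by exists (fun=> 0); rewrite big1 // => i _; rewrite mul0r.
  - move=> x y [r ->] [r' ->]; exists (fun i => r i + r' i); rewrite -big_split.
    by apply: eq_bigr => i _; rewrite mulrDl.
  - move=> x y [r ->]; exists (fun i => x * r i); rewrite big_distrr.
    by apply: eq_bigr => i _ /=; rewrite mulrA.
  - move=> i; exists (N + M)%N, (fun j => (j == i)%:R).
    by rewrite (bigD1 i) //= eqxx mul1r big1 ?addr0 // => j /negbTE->; rewrite mul0r.
(* As with a partition of unity: multiplying this sum by [F i] gives [a' i], because a'_j F_i = a'_i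
   F_j. *)
exists (\sum_j r j * a' j) => i.
have [[v fv] _ _] := loc i.
have Fv : phi i (F i) * v ^+ (N + M) = 1 by rewrite rmorphXn -exprMn fv expr1n.
rewrite -[LHS]mulr1 -[RHS]mulr1 -Fv !mulrA; congr (_ * _).
rewrite bF -rmorphM; congr (phi i _); rewrite big_distrl /=.
rewrite -[RHS]mulr1 r1 big_distrr; apply: eq_bigr => j _ /=.
by rewrite -mulrA aF mulrCA.
Qed.
End Cover.

(** The image of each r in [R] is glued separately; separatedness then makes the result a ring
    morphism. *)
Lemma Spec_sheaf (R : comPzRingType) : zariski_sheaf (Spec R).
Proof.
move=> A n f B phi cover loc x compat; have sep := cover_separated cover loc.
have /choice[y yE] : forall r, exists a, forall i, phi i a = x i r.
  move=> r; apply: (cover_glue cover loc) => i j C g h e.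
  exact: (congr1 (fun m : {rmorphism R -> C} => m r) (compat i j C g h e)).
have yN : nmod_morphism y.
  split=> [|r s]; apply: sep => i; first by rewrite yE !rmorph0.
  by rewrite rmorphD !yE rmorphD.
have yM : monoid_morphism y.
  split=> [|r s]; apply: sep => i; first by rewrite yE !rmorph1.
  by rewrite rmorphM !yE rmorphM.
exists (mk_rmorphism yN yM : {rmorphism R -> A}); split=> [i|z zE].
  by apply: rmorphism_ext => r; apply: yE.
apply: rmorphism_ext => r; apply: sep => i; rewrite [LHS]yE -(zE i); done.
Qed.

Definition zid (X : zfunctor) : zmorphism X X :=
  @ZMorphism X X (fun A x => x) (fun A B f x => erefl).

Lemma zid_open (X : zfunctor) : open_immersion (zid X).
Proof.
split=> [A x y //|A x]; exists (fun=> True) => B phi; split=> _.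
  exists 1%N, (fun=> 1), (fun=> 1); split=> //.
  by rewrite big_ord1 rmorph1 mulr1.
by exists (Defs.pmap X phi x).
Qed.

Lemma Spec_is_scheme (R : comPzRingType) : is_scheme (Spec R).
Proof.
split; first exact: Spec_sheaf.
exists unit, (fun=> R), (fun=> zid (Spec R)); split=> [_|K x].
  exact: zid_open.
by exists tt, x.
Qed.

(* An affine open subscheme becomes an isomorphism over each D(a) that it contains. *)
Lemma open_immersion_local (R B : comPzRingType) (u : zmorphism (Spec B) (Spec R)) :
  open_immersion u ->
  exists n (a : 'I_n -> R) (b : 'I_n -> B),
    \sum_i b i * Spec_point u (a i) = 1 /\
    forall i, is_localization (Spec_point u (a i)) (@to_loc B (Spec_point u (a i))) /\
      exists psi : {rmorphism B -> localization (a i)},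
        (forall r, psi (Spec_point u r) = to_loc (a i) r) /\
        forall b, psi b = 0 -> exists m, Spec_point u (a i) ^+ m * b = 0.
Proof.
move=> [mono /(_ R (idfun : {rmorphism R -> R}))[J JE]].
set phi : {rmorphism R -> B} := Spec_point u.
have uE (C : comPzRingType) (x : {rmorphism B -> C}) r : u C x r = x (phi r).
  have := zmap_nat u x (idfun : {rmorphism B -> B}).
  move=> /(congr1 (fun m : {rmorphism R -> C} => m r)) /= <-.
  by congr (u C _ r); apply: rmorphism_ext.
(* The point [phi] lies in the image of [u], so [J] generates the unit ideal of [B]. *)
have [|n [a [b [aJ b1]]]] := (JE B phi).1.
  by exists (idfun : {rmorphism B -> B}); apply: rmorphism_ext.
exists n, a, b; split=> // i; split; first exact: to_locP.
have [[v av] _ _] := to_locP (a i).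
(* D(a_i) is contained in the open subscheme, so the map from [R] to its localization at [a i]
   factors through [phi]. *)
have [|psi psiE] := (JE _ (@to_loc R (a i))).2.
  exists 1%N, (fun=> a i), (fun=> v); split=> //.
  by rewrite big_ord1 mulrC.
have psi_phi r : psi (phi r) = to_loc (a i) r by rewrite -uE psiE.
exists psi; split=> // c c0.
have [[w aw] _ ker] := to_locP (phi (a i)).
have aw' : (to_loc (phi (a i)) \o phi) (a i) * w = 1 by [].
have [g gE] := localization_lift (to_locP (a i)) aw'.
apply: ker; rewrite -(rmorph0 g) -c0.
(* Both sides are points of Spec B with the same image in Spec R, and [u] is a monomorphism. *)
suff -> : @to_loc B (phi (a i)) = g \o psi :> {rmorphism B -> _} by [].
apply: mono; apply: rmorphism_ext => r; rewrite !uE /=.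
by rewrite psi_phi gE.
Qed.

(** That the annihilator of [t] lies in (t) is a local condition, so it passes from [R] to an affine
    open subscheme. *)
Lemma open_immersion_ann (R B : comPzRingType) (u : zmorphism (Spec B) (Spec R)) (t : R) :
  open_immersion u -> (forall r, t * r = 0 -> exists r', r = t * r') ->
  forall b, Spec_point u t * b = 0 -> exists b', b = Spec_point u t * b'.
Proof.
move=> /open_immersion_local[n [a [c [c1 loc]]]] annt b tb.
set phi := Spec_point u in c1 loc tb *.
suff [b' e] : exists b', 1 * b = phi t * b' by exists b'; rewrite -e mul1r.
(* The y with y b in (t) form an ideal; it suffices that it contains a power of each [phi (a i)]. *)
apply: (@unit_ideal_powers B n c (fun i => phi (a i))
  (fun y => exists b', y * b = phi t * b')) => //.
- by exists 0; rewrite mul0r mulr0.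
- by move=> x y [x' ex] [y' ey]; exists (x' + y'); rewrite mulrDl ex ey mulrDr.
- by move=> x y [y' ey]; exists (x * y'); rewrite -mulrA ey mulrCA.
move=> i; have [_ [psi [psi_phi kerpsi]]] := loc i.
have [_ fracE ker] := to_locP (a i).
have [r [m rE]] := fracE (psi b).
have [k kE] : exists k, phi (a i) ^+ k * (b * phi (a i) ^+ m - phi r) = 0.
  by apply: kerpsi; rewrite rmorphB rmorphM rmorphXn !psi_phi rE subrr.
have [l lE] : exists l, a i ^+ l * (t * r) = 0.
  apply: ker; rewrite rmorphM -rE.
  transitivity (psi (phi t) * psi b * to_loc (a i) (a i) ^+ m).
    by rewrite psi_phi mulrA.
  by rewrite -rmorphM tb rmorph0 mul0r.
have [r' r'E] : exists r', a i ^+ l * r = t * r'.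
  by apply: annt; rewrite mulrCA.
exists (l + k + m)%N, (phi (a i) ^+ k * phi r'); rewrite !exprD.
have {}kE : phi (a i) ^+ k * (b * phi (a i) ^+ m) = phi (a i) ^+ k * phi r.
  by apply/eqP; rewrite -subr_eq0 -mulrBr kE.
transitivity (phi (a i) ^+ l * (phi (a i) ^+ k * (b * phi (a i) ^+ m))); first by pow_ring.
rewrite kE [LHS]mulrCA -(rmorphXn phi l) -(rmorphM phi (a i ^+ l)) r'E.
by rewrite rmorphM mulrCA.
Qed.

(** * Flatness *)

Section TensorGenerators.
Variables (L B : comPzRingType) (s : {rmorphism L -> B}).
Variables (M : lmodType L) (T : zmodType) (t : M -> B -> T).

Lemma tensor_additive_unique (G : zmodType) (h h' : {additive T -> G}) :
  is_tensor s t -> (forall m b, h (t m b) = h' (t m b)) -> h =1 h'.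
Proof.
move=> [[tD tD' tZ] univ] e.
have [|g _ gU] := univ G (fun m b => h' (t m b)).
  by split=> *; rewrite ?tD ?tD' ?tZ ?raddfD.
by move=> x; rewrite (gU h e) (gU h').
Qed.

(** The projection of [T] to its quotient by [P] kills all pure tensors, hence is zero. *)
Lemma tensor_ind (P : {pred T}) : is_tensor s t -> zmod_closed P ->
  (forall m b, t m b \in P) -> forall x, x \in P.
Proof.
move=> tens Pz tP x.
pose Pm := GRing.isZmodClosed.Build T P Pz.
pose Pc : zmodClosed T := HB.pack P Pm.
pose Q : zmodType := Quotient.quot Pc.
have piN : nmod_morphism (fun y : T => \pi_Q y : Q)%qT.
  by split=> [|y z]; rewrite ?raddf0 // piE.
pose pim := GRing.isNmodMorphism.Build T Q _ piN.
pose pi : {additive T -> Q} := HB.pack (fun y : T => \pi_Q y : Q)%qT pim.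
pose z : {additive T -> Q} := GRing.null_fun Q.
have : pi x = z x.
  apply: tensor_additive_unique => // m b /=.
  by rewrite -(raddf0 pi); apply/eqP; rewrite -Quotient.idealrBE subr0; apply: tP.
rewrite -[z x](raddf0 pi) => /eqP.
by rewrite -[_ == _]Quotient.idealrBE subr0.
Qed.
End TensorGenerators.

Section Balanced.
Variables (L B : comPzRingType) (s : {rmorphism L -> B}).
Variables (M : lmodType L) (T : zmodType) (t : M -> B -> T).
Hypothesis bal : balanced s t.

Lemma balanced0l b : t 0 b = 0.
Proof.
by have [tD _ _] := bal; apply: (addrI (t 0 b)); rewrite -tD !addr0.
Qed.

Lemma balancedBl m m' b : t (m - m') b = t m b - t m' b.
Proof.
by have [tD _ _] := bal; apply/eqP; rewrite -subr_eq opprK -tD subrK.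
Qed.

Lemma balanced_sumr m (I : Type) (l : seq I) (F : I -> B) :
  t m (\sum_(i <- l) F i) = \sum_(i <- l) t m (F i).
Proof.
have [_ tD _] := bal.
have t0 : t m 0 = 0 by apply: (addrI (t m 0)); rewrite -tD !addr0.
exact: (big_morph (t m) (tD m) t0).
Qed.
End Balanced.

(* Over a local ring whose maximal ideal (t) has square zero, a module in which the
   annihilator of t is tB is free on a lift of a basis of B/tB. *)
Section SquareZeroFlat.
Variables (L B : comPzRingType) (s : {rmorphism L -> B}) (t : L).
Hypothesis t2 : t * t = 0.
Hypothesis local : forall r, (exists r', r = t * r') \/ (exists u, r * u = 1).
Hypothesis annB : forall b, s t * b = 0 -> exists b', b = s t * b'.

Let in_tL r := exists r', r = t * r'.
Let in_tB b := exists b', b = s t * b'.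

(** Linear independence over L/tL of the images in B/tB. *)
Definition independent_mod (E : B -> Prop) := forall (c : B -> L) (l : seq B),
  uniq l -> (forall e, e \in l -> E e) -> in_tB (\sum_(e <- l) s (c e) * e) ->
  forall e, e \in l -> in_tL (c e).

Lemma max_independent_mod : exists E, independent_mod E /\
  forall b, ~ E b -> ~ independent_mod (fun e => E e \/ e = b).
Proof.
have [|E [indE maxE]] := @classical_sets.Zorn_bigcup B independent_mod.
  move=> F Find Ftot c l ul lF.
  have [[e el]|l0] := pselect (exists e, e \in l); last first.
    by move=> _ e el; case: l0; exists e.
  have [X0 FX0 _] := lF _ el.
  (* Finitely many elements of the union of a chain lie in a single member. *)
  have [X FX lX] : exists2 X, F X & forall e, e \in l -> X e.
    elim: l {ul e el} lF => [|x l IH] lF; first by exists X0.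
    have [|X FX lX] := IH; first by move=> y yl; apply: lF; rewrite inE yl orbT.
    have [Y FY Yx] := lF x (mem_head x l).
    have [XY|YX] := Ftot X Y FX FY.
      by exists Y => // y; rewrite inE => /predU1P[->//|/lX/XY].
    by exists X => // y; rewrite inE => /predU1P[->|/lX//]; apply: YX.
  exact: Find lX.
exists E; split=> // b nEb indEb.
apply: (maxE (fun e => E e \/ e = b)) => //; split; first by move=> e; left.
by move=> /(_ b (or_intror erefl)).
Qed.

Section Coordinates.
Variable E : B -> Prop.
Hypothesis indE : independent_mod E.
Hypothesis maxE : forall b, ~ E b -> ~ independent_mod (fun e => E e \/ e = b).

(** The coordinates [c] are supported on the finite list [l]. The expansion is required on every
    larger list, so that two representations can be compared on a common one. *)
Definition represents (b : B) (c : B -> L) := exists l : seq B,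
  [/\ forall e, e \in l -> E e, forall e, e \notin l -> c e = 0
    & forall l', uniq l' -> {subset l <= l'} -> b = \sum_(e <- l') s (c e) * e].

Lemma represents_sum (l : seq B) (c : B -> L) :
  uniq l -> (forall e, e \in l -> E e) ->
  represents (\sum_(e <- l) s (c e) * e) (fun e => if e \in l then c e else 0).
Proof.
move=> ul lE; exists l; split=> // [e /negbTE->//|l' ul' ll'].
rewrite [RHS](bigID (mem l)) /= [X in _ + X]big1 ?addr0; last first.
  by move=> e /negbTE->; rewrite rmorph0 mul0r.
rewrite -[RHS]big_filter [RHS](perm_big l) /=; last first.
  apply: uniq_perm; rewrite ?filter_uniq // => e.
  by rewrite mem_filter andbC; case el: (e \in l); rewrite ?andbF // (ll' _ el).
by apply: eq_big_seq => e ->.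
Qed.

Lemma representsD b b' c c' :
  represents b c -> represents b' c' -> represents (b + b') (fun e => c e + c' e).
Proof.
move=> [l [lE l0 lS]] [l' [l'E l'0 l'S]]; exists (l ++ l'); split.
- by move=> e; rewrite mem_cat => /orP[/lE|/l'E].
- by move=> e; rewrite mem_cat negb_or => /andP[/l0-> /l'0->]; rewrite addr0.
- move=> k uk lk; rewrite (lS k uk) ?(l'S k uk) -?big_split.
  + by apply: eq_bigr => e _; rewrite rmorphD mulrDl.
  + by move=> e el; apply: lk; rewrite mem_cat el orbT.
  + by move=> e el; apply: lk; rewrite mem_cat el.
Qed.

Lemma representsZ r b c : represents b c -> represents (s r * b) (fun e => r * c e).
Proof.
move=> [l [lE l0 lS]]; exists l; split=> // [e /l0->|k uk lk]; first by rewrite mulr0.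
by rewrite (lS k uk lk) big_distrr; apply: eq_bigr => e _; rewrite /= rmorphM mulrA.
Qed.

(** Independence puts the coordinates in tL. Writing c = t d, the hypothesis on annihilators puts
    the combination with coefficients [d] in tB, so [d] is in tL too and c = 0 because t^2 = 0. *)
Lemma represents0 c : represents 0 c -> forall e, c e = 0.
Proof.
move=> [l [lE l0 /(_ (undup l) (undup_uniq l))]] S.
have {}S : 0 = \sum_(e <- undup l) s (c e) * e by apply: S => e; rewrite mem_undup.
have uE e : e \in undup l -> E e by rewrite mem_undup; apply: lE.
have ctL e : e \in l -> in_tL (c e).
  rewrite -mem_undup; apply: indE (undup_uniq l) uE _ e.
  by exists 0; rewrite -S mulr0.
have /choice[d dE] e : in_tL (c e).
  have [/ctL//|/l0->] := boolP (e \in l); by exists 0; rewrite mulr0.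
move=> e; have [|/l0//] := boolP (e \in l); rewrite -mem_undup => el.
have [|d' d'E] := indE (c := d) (undup_uniq l) uE _ el.
  apply: annB; rewrite [RHS]S big_distrr; apply: eq_bigr => i _ /=.
  by rewrite [c i]dE rmorphM mulrA.
by rewrite dE d'E mulrA t2 mul0r.
Qed.

(** By maximality, some [b] outside [E] satisfies a relation with a coefficient outside tL. Were the
    coefficient of [b] in tL, the rest would contradict the independence of [E]; so it is a unit and
    one solves for [b]. *)
Lemma represents_mod b : exists c b', represents (b - s t * b') c.
Proof.
have [Eb|nEb] := pselect (E b).
  exists (fun e => if e \in [:: b] then 1 else 0), 0.
  have /= := @represents_sum [:: b] (fun=> 1).
  rewrite big_seq1 rmorph1 mul1r mulr0 subr0; apply=> // e.
  by rewrite inE => /eqP->.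
have [c [l [ul lE [b'' lS] [e el ce]]]] : exists c l, [/\ uniq l,
    forall e, e \in l -> E e \/ e = b, in_tB (\sum_(e <- l) s (c e) * e)
    & exists2 e, e \in l & ~ in_tL (c e)].
  apply: contrapT => no; apply: (maxE nEb) => c l ul lE lS e el.
  by apply: contrapT => ce; apply: no; exists c, l; split=> //; exists e.
have remE x : x \in rem b l -> E x.
  by rewrite mem_rem_uniq // inE => /andP[/eqP xb /lE[]].
have [bl|bl] := boolP (b \in l); last first.
  have lE' x : x \in l -> E x.
    by move=> xl; have [//|xb] := lE x xl; rewrite -xb xl in bl.
  by case: (ce (indE ul lE' (ex_intro _ b'' lS) el)).
have Sb : s t * b'' = s (c b) * b + \sum_(x <- rem b l) s (c x) * x.
  by rewrite -lS (perm_big _ (perm_to_rem bl)) big_cons.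
have [[r cb]|[u cu]] := local (c b).
  case: ce; have [eb|eb] := eqVneq e b; first by rewrite eb; exists r.
  have er : e \in rem b l by rewrite mem_rem_uniq // inE eb.
  apply: (indE (rem_uniq b ul) remE _ er).
  exists (b'' - s r * b); rewrite mulrBr Sb cb rmorphM mulrA.
  by rewrite addrAC subrr add0r.
exists (fun x => - u * (if x \in rem b l then c x else 0)), (s u * b'').
rewrite (_ : b - _ = s (- u) * \sum_(x <- rem b l) s (c x) * x).
  exact/representsZ/represents_sum/remE/(rem_uniq b ul).
have ub : s u * (s (c b) * b) = b by rewrite mulrA -rmorphM (mulrC u) cu rmorph1 mul1r.
by rewrite mulrCA Sb mulrDr ub opprD addrA subrr add0r rmorphN mulNr.
Qed.

(** Expanding the remainder once more leaves an error in t^2 B = 0. *)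
Lemma represents_ex b : exists c, represents b c.
Proof.
have [c [b' bE]] := represents_mod b; have [c' [b'' b'E]] := represents_mod b'.
exists (fun e => c e + t * c' e).
rewrite -(subrK (s t * b') b); apply: representsD => //.
have := representsZ t b'E.
by rewrite mulrBr mulrA -rmorphM t2 rmorph0 mul0r subr0.
Qed.
End Coordinates.

Lemma flat_square_zero : flat_hom s.
Proof.
have [E [indE maxE]] := max_independent_mod.
have /choice[x xE] := represents_ex indE maxE.
(* Uniqueness of coordinates makes each of them L-linear in [b]. *)
have x_unique b c : represents E b c -> forall e, x b e = c e.
  move=> bc e; apply/eqP; rewrite -subr_eq0; apply/eqP.
  have := representsD (xE b) (representsZ (-1) bc).
  rewrite rmorphN1 mulN1r subrr => /(represents0 indE) /(_ e).
  by rewrite mulN1r.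
have xD b b' e : x (b + b') e = x b e + x b' e.
  exact: x_unique (representsD (xE b) (xE b')) e.
have xZ r b e : x (s r * b) e = r * x b e.
  exact: x_unique (representsZ r (xE b)) e.
(* The coordinate at [e] induces a map from the tensor product to [M]. *)
have coord (M : lmodType L) (T : zmodType) (f : M -> B -> T) : is_tensor s f ->
    exists g : B -> {additive T -> M}, forall e m b, g e (f m b) = x b e *: m.
  move=> [_ univ]; suff /choice[g gE] : forall e, exists g : {additive T -> M},
    forall m b, g (f m b) = x b e *: m.
    by exists g => e m b; apply: gE.
  move=> e; have [|g gE _] := univ M (fun m b => x b e *: m); last by exists g.
  split=> *; rewrite ?scalerDr ?xD ?scalerDl //.
  by rewrite xZ scalerA mulrC.
move=> M N j j_inj S T tM tN tensM tensN h hE.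
have [lam lamE] := coord _ _ _ tensM; have [mu muE] := coord _ _ _ tensN.
have lam_mu e y : j (lam e y) = mu e (h y).
  apply: (tensor_additive_unique (h := j \o lam e) (h' := mu e \o h) tensM) => m b /=.
  by rewrite lamE hE muE linearZ.
have bal := tensM.1.
pose P : {pred S} := fun y => `[< exists l : seq B, forall l', uniq l' -> {subset l <= l'} ->
  y = \sum_(e <- l') tM (lam e y) e >].
(* Every tensor is recovered from its coordinates. These commute with [j] and [h], so injectivity of
   [j] makes all coordinates of an element of the kernel of [h] vanish. *)
have allP : forall y, y \in P.
  apply: (tensor_ind tensM).
    split.
      apply/asboolP; exists [::] => l' _ _; rewrite big1 // => e _.
      by rewrite raddf0 (balanced0l bal).
    move=> y z /asboolP[l lS] /asboolP[l' l'S]; apply/asboolP.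
    exists (l ++ l') => k uk lk.
    have ky : y = \sum_(e <- k) tM (lam e y) e.
      by apply: lS uk _ => e el; apply: lk; rewrite mem_cat el.
    have kz : z = \sum_(e <- k) tM (lam e z) e.
      by apply: l'S uk _ => e el; apply: lk; rewrite mem_cat el orbT.
    transitivity (\sum_(e <- k) tM (lam e y) e - \sum_(e <- k) tM (lam e z) e).
      by rewrite -ky -kz.
    by rewrite -sumrB; apply: eq_bigr => e _; rewrite raddfB (balancedBl bal).
  move=> m b; apply/asboolP; have [l [_ _ lS]] := xE b.
  exists l => l' ul' ll'; rewrite [in LHS](lS l' ul' ll') (balanced_sumr bal).
  by apply: eq_bigr => e _; rewrite lamE; have [_ _ ->] := bal.
apply: raddf_inj => y hy; have /asboolP[l lS] := allP y.
rewrite [LHS](lS (undup l) (undup_uniq l)); last by move=> e; rewrite mem_undup.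
apply: big1 => e _; rewrite (_ : lam e y = 0) ?(balanced0l bal) //.
by apply: j_inj; rewrite lam_mu hy !raddf0.
Qed.
End SquareZeroFlat.

(** * Affine F-liftings over W_2(k) in characteristic two *)

Section WittTwo.
Variables (k : closedFieldType) (chk : 2%N \in [pchar k]).
Local Notation W := (witt2 chk).

Lemma witt2_oner_neq0 : (1 : W) != 0.
Proof. by apply/eqP => /(congr1 (@witt_c0 2 k chk)) /eqP; rewrite oner_eq0. Qed.
HB.instance Definition _ := GRing.PzSemiRing_isNonZero.Build W witt2_oner_neq0.

(** In characteristic 2, multiplication by 2 is Frobenius followed by Verschiebung; the sign comes
    from the carry. *)
Lemma witt2_mul2 (u : W) : 2%:R * u = Witt2 chk 0 (- witt_c0 u ^+ 2).
Proof.
have -> : 2%:R = Witt2 chk 0 (- 1).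
  rewrite mulr2n; congr Witt2 => /=; first by rewrite addrr_pchar2.
  by rewrite /witt_carry big_nat1 /= !expr1n mul1r add0r sub0r.
by congr Witt2; rewrite /= ?mul0r // expr0n mul0r add0r mulrN1.
Qed.

(** This holds because [k] is perfect: the required square root exists in an algebraically closed
    field. *)
Lemma witt_c0_eq0 (u : W) : witt_c0 u = 0 <-> exists v, u = 2%:R * v.
Proof.
split=> [u0|[v ->]]; last by rewrite witt2_mul2.
have [r rE] := @solve_monicpoly k 2 (fun i => if i == 0%N then - witt_c1 u else 0) isT.
exists (Witt2 chk r 0); rewrite witt2_mul2 /= rE !big_ord_recl big_ord0 /=.
by rewrite mul0r !addr0 mulr1 opprK; case: u u0 rE => u v /= ->.
Qed.

Lemma witt2_ann2 (u : W) : 2%:R * u = 0 -> witt_c0 u = 0.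
Proof.
rewrite witt2_mul2 => /(congr1 (@witt_c1 2 k chk)) /= /eqP.
by rewrite oppr_eq0 sqrf_eq0 => /eqP.
Qed.

Lemma witt2_4 : 2%:R * 2%:R = 0 :> W.
Proof. by rewrite witt2_mul2 /= addrr_pchar2 // expr0n oppr0. Qed.

Lemma witt2_local (u : W) : (exists v, u = 2%:R * v) \/ (exists v, u * v = 1).
Proof.
have [/witt_c0_eq0|u0] := eqVneq (witt_c0 u) 0; first by left.
(* For u = (a, b), the second coordinate c of the inverse solves a^2 c + a^(-2) b = 0. *)
right; exists (Witt2 chk (witt_c0 u)^-1 (- witt_c1 u / witt_c0 u ^+ 4)).
case: u u0 => a b /= a0; congr Witt2; rewrite /= ?divff //.
by field.
Qed.

(** The lift is [Spec A']. The kernel of [q] being 2A' gives the fibre product, and the condition on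
    the annihilator of 2 gives flatness, carried to affine opens by [open_immersion_ann]. *)
Lemma affine_F_liftable (A A' : comPzRingType) (st : {rmorphism k -> A})
    (st' : {rmorphism W -> A'}) (q : {rmorphism A' -> A}) (Phi : {rmorphism A' -> A'}) :
  (forall a, exists a', q a' = a) ->
  (forall a' : A', q a' = 0 <-> exists b, a' = 2%:R * b) ->
  (forall a' : A', 2%:R * a' = 0 -> exists b, a' = 2%:R * b) ->
  (forall w, q (st' w) = st (witt_c0 w)) ->
  (forall w, Phi (st' w) = st' (witt2_Frobenius w)) ->
  (forall a, q (Phi a) = q a ^+ 2) ->
  F_liftable chk (Spec_map st).
Proof.
move=> q_surj q_ker ann2 q_st Phi_st q_Phi.
exists (Spec A'), (Spec_map st'), (Spec_map q), (Spec_map Phi); split.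
- exact: Spec_is_scheme.
- move=> B u uo; apply: (@flat_square_zero _ _ _ 2%:R witt2_4 witt2_local) => b.
  rewrite rmorph_nat => b2.
  have := open_immersion_ann uo ann2 (b := b); rewrite rmorph_nat; exact.
- split=> [C x y /= xy|C x].
    apply: rmorphism_ext => a; have [a' <-] := q_surj a.
    exact: (congr1 (fun m : {rmorphism A' -> C} => m a') xy).
  exists (fun c => exists2 a', q a' = 0 & c = x a') => B phi; split.
    move=> [y yE] _ [a' a'0 ->].
    have /= <- := congr1 (fun m : {rmorphism A' -> B} => m a') yE.
    by rewrite a'0 rmorph0.
  move=> ker.
  have [|y yE] := @rmorphism_factor _ _ _ q (phi \o x) q_surj.
    by move=> a' a'0; apply: ker; exists a'.
  by exists y; apply: rmorphism_ext.
- split=> [C w|C x y e]; first by apply: rmorphism_ext => v /=; rewrite q_st.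
  have eE w : x (st' w) = y (witt_c0 w).
    exact: (congr1 (fun m : {rmorphism W -> C} => m w) e).
  have [|z zE] := @rmorphism_factor _ _ _ q x q_surj.
    move=> a' /q_ker[b ->]; rewrite rmorphM rmorph_nat -(rmorph_nat y) (pcharf0 chk).
    by rewrite rmorph0 mul0r.
  exists z; split=> [|z' [z'x _]].
    split; apply: rmorphism_ext => // r /=.
    by rewrite -[r]/(witt_c0 (Witt2 chk r 0)) -q_st zE eE.
  apply: rmorphism_ext => a; have [a' <-] := q_surj a.
  by rewrite zE -z'x.
- split=> [C y|C x]; first by apply: rmorphism_ext => w /=; rewrite Phi_st.
  apply: rmorphism_ext => a /=.
  by rewrite q_Phi rmorphXn.
Qed.
End WittTwo.

(** * Lifting quotients of polynomial rings *)

Lemma mpoly_rmorphism_ext n (R : comNzRingType) (S : comPzRingType)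
    (f g : {rmorphism {mpoly R[n]} -> S}) :
  (forall c, f c%:MP = g c%:MP) -> (forall i, f 'X_i = g 'X_i) -> f =1 g.
Proof.
move=> fgC fgX p; rewrite (mpolyE p) !raddf_sum; apply: eq_bigr => m _ /=.
rewrite -mul_mpolyC !rmorphM fgC mpolyXE_id !rmorph_prod; congr (_ * _).
by apply: eq_bigr => i _; rewrite !rmorphXn fgX.
Qed.

Lemma gen_idealE (A : comPzRingType) (s : seq A) (x : A) :
  gen_ideal s x <-> exists c : nat -> A, x = \sum_(0 <= i < size s) c i * s`_i.
Proof.
split=> -[c ->]; last by exists (fun i => c i); rewrite big_mkord.
exists (fun i => if insub i is Some j then c j else 0); rewrite big_mkord.
by apply: eq_bigr => i _; rewrite valK.
Qed.

Section MpolyLift.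
Variables (k : closedFieldType) (chk : 2%N \in [pchar k]) (n : nat).
Local Notation W := (witt2 chk).
Local Notation P := {mpoly W[n]}.

Definition reduction : P -> {mpoly k[n]} := map_mpoly (@witt_c0 2 k chk).
HB.instance Definition _ := GRing.RMorphism.on reduction.

Lemma reductionC c : reduction c%:MP = (witt_c0 c)%:MP.
Proof. exact: map_mpolyC. Qed.

Lemma reductionX i : reduction 'X_i = 'X_i.
Proof. exact: map_mpolyX. Qed.

Lemma reduction_coef F m : (reduction F)@_m = witt_c0 F@_m.
Proof. exact: mcoeff_map_mpoly. Qed.

Lemma reduction_surj (G : {mpoly k[n]}) : exists F, reduction F = G.
Proof.
(* Coefficients are lifted to their Teichmuller representatives. *)
exists (\sum_(m <- msupp G) (Witt2 chk G@_m 0)%:MP * 'X_[m]).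
rewrite [RHS]mpolyE raddf_sum; apply: eq_bigr => m _ /=.
by rewrite rmorphM /= reductionC /reduction map_mpolyX mul_mpolyC.
Qed.

Lemma reduction_eq0 (F : P) : reduction F = 0 <-> exists G, F = 2%:R * G.
Proof.
split=> [F0|[G ->]]; last first.
  rewrite rmorphM rmorph_nat -(rmorph_nat (@mpolyC n k)) (pcharf0 chk).
  by rewrite rmorph0 mul0r.
have /choice[g gE] m : exists v, F@_m = 2%:R * v.
  by apply/witt_c0_eq0; rewrite -reduction_coef F0 mcoeff0.
exists (\sum_(m <- msupp F) (g m)%:MP * 'X_[m]).
rewrite [LHS]mpolyE big_distrr; apply: eq_bigr => m _ /=.
by rewrite gE mulrA -mul_mpolyC -(rmorph_nat (@mpolyC n W)) -rmorphM.
Qed.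

Lemma reduction_ann2 (F : P) : 2%:R * F = 0 -> reduction F = 0.
Proof.
move=> F2; apply/mpolyP => m; rewrite reduction_coef mcoeff0; apply: witt2_ann2.
by rewrite mulr_natl -mcoeffMn -mulr_natl F2 mcoeff0.
Qed.

Lemma mpoly_witt_4 : 2%:R * 2%:R = 0 :> P.
Proof. by rewrite -(rmorph_nat (@mpolyC n W)) -rmorphM witt2_4 rmorph0. Qed.

Section FrobeniusLift.
Variable D : 'I_n -> P.

Definition Frobenius_lift : P -> P :=
  mmap (@mpolyC n W \o @witt2_Frobenius 2 k chk) (fun i => 'X_i ^+ 2 + 2%:R * D i).
HB.instance Definition _ := GRing.RMorphism.on Frobenius_lift.
Local Notation phi := Frobenius_lift.

Lemma Frobenius_liftC c : phi c%:MP = (witt2_Frobenius c)%:MP.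
Proof. by rewrite /phi mmapC. Qed.

Lemma Frobenius_liftX i : phi 'X_i = 'X_i ^+ 2 + 2%:R * D i.
Proof. by rewrite /phi mmapX mmap1U. Qed.

Lemma reduction_Frobenius F : reduction (phi F) = reduction F ^+ 2.
Proof.
pose chp : 2%N \in [pchar {mpoly k[n]}] := rmorph_pchar (@mpolyC n k) chk.
rewrite -[RHS](pFrobenius_autE chp).
apply: (mpoly_rmorphism_ext (f := reduction \o phi)
  (g := pFrobenius_aut chp \o reduction)) => [c|i] /=; rewrite pFrobenius_autE.
  by rewrite Frobenius_liftC !reductionC -rmorphXn.
rewrite Frobenius_liftX rmorphD rmorphXn (rmorphM _ 2%:R) rmorph_nat.
by rewrite (pcharf0 chp) mul0r addr0.
Qed.

(** [d] is the value at [x] of the 2-derivation attached to [phi]. It is determined only modulo 2,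
    hence a relation. *)
Definition has_delta (x d : P) := phi x = x ^+ 2 + 2%:R * d.

Lemma has_delta_ex x : exists d, has_delta x d.
Proof.
have [|d dE] := (reduction_eq0 (phi x - x ^+ 2)).1.
  by rewrite rmorphB rmorphXn /= reduction_Frobenius subrr.
by exists d; rewrite /has_delta -dE addrC subrK.
Qed.

Lemma has_deltaX i : has_delta 'X_i (D i).
Proof. exact: Frobenius_liftX. Qed.

Lemma has_deltaD x d y e :
  has_delta x d -> has_delta y e -> has_delta (x + y) (d + e - x * y).
Proof. by rewrite /has_delta rmorphD /= => -> ->; ring. Qed.

Lemma has_deltaM x d y e :
  has_delta x d -> has_delta y e -> has_delta (x * y) (x ^+ 2 * e + y ^+ 2 * d).
Proof.
rewrite /has_delta rmorphM /= => -> ->.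
rewrite (_ : _ * _ = (x * y) ^+ 2 + 2%:R * (x ^+ 2 * e + y ^+ 2 * d)
  + (2%:R * 2%:R) * (d * e)); last by ring.
by rewrite mpoly_witt_4 mul0r addr0.
Qed.

(** For a = 0 the truncated predecessor does no harm, the coefficient being 0. *)
Lemma has_delta_exp x d a :
  has_delta x d -> has_delta (x ^+ a) (a%:R * x ^+ (2 * a.-1) * d).
Proof.
move=> xd; elim: a => [|a IH]; first by rewrite /has_delta rmorph1 !mul0r mulr0 addr0 expr1n.
rewrite exprS; suff <- : x ^+ 2 * (a%:R * x ^+ (2 * a.-1) * d) + (x ^+ a) ^+ 2 * d
    = a.+1%:R * x ^+ (2 * a.+1.-1) * d by apply: has_deltaM.
case: a {IH} => [|a] /=; first by rewrite !mul0r mulr0 add0r muln0 !expr0 expr1n !mul1r.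
rewrite -exprM (mulnC a.+1) mulnS exprD -[a.+2%:R]natr1.
by move: (a.+1%:R : P) (x ^+ (2 * a)) => ? ?; ring.
Qed.

(** Since 4 = 0, the square of 2u vanishes and phi(2u) = 2 u^2. Thus changing the lift of an
    equation by 2u contributes u^2. *)
Lemma has_delta_double u : has_delta (2%:R * u) (u ^+ 2).
Proof.
have [d ud] := has_delta_ex u.
rewrite /has_delta rmorphM rmorph_nat /= ud mulrDr [2%:R * (2%:R * d)]mulrA.
by rewrite exprMn (expr2 2%:R) mpoly_witt_4 !mul0r add0r addr0.
Qed.

End FrobeniusLift.

(** The first hypothesis, that the ideal meets (2) only in its own doubles, gives flatness over
    W_2(k); the second makes the Frobenius lift descend. *)
Lemma F_liftable_quotient (D : 'I_n -> P) (s : seq P) :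
  (forall x, gen_ideal s x -> reduction x = 0 ->
     exists2 y, gen_ideal s y & x = 2%:R * y) ->
  (forall i, (i < size s)%N -> exists2 d, has_delta D s`_i d &
     gen_ideal [seq reduction f | f <- s] (reduction d)) ->
  F_liftable chk (Spec_quotient_structure [seq reduction f | f <- s]).
Proof.
move=> syz del; set sk := map _ s.
(* The preimage of the reduced ideal is the lifted ideal plus (2). *)
have lift_ideal F : gen_ideal sk (reduction F) <->
    exists2 G, gen_ideal s G & exists H, F = G + 2%:R * H.
  split=> [/gen_idealE[c cE]|[_ /gen_idealE[c ->] [H ->]]]; last first.
    apply/gen_idealE; exists (fun i => reduction (c i)).
    have H0 : reduction (2%:R * H) = 0 by apply/reduction_eq0; exists H.
    rewrite rmorphD /= H0 addr0 rmorph_sum size_map; apply: eq_big_nat => i /andP[_ il].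
    by rewrite rmorphM (nth_map 0).
  have /choice[C CE] i := reduction_surj (c i).
  exists (\sum_(0 <= i < size s) C i * s`_i); first by apply/gen_idealE; exists C.
  set G := \sum_(_ <= _ < _) _; have [|H HE] := (reduction_eq0 (F - G)).1.
    rewrite rmorphB /= cE size_map rmorph_sum -sumrB big_nat big1 // => i /andP[_ il].
    by rewrite rmorphM /= CE (nth_map 0) // subrr.
  by exists H; rewrite -HE addrC subrK.
have idealM a x : gen_ideal s x -> gen_ideal s (a * x).
  by move=> h; apply/asboolP/gen_idealMl/asboolP.
have idealD x y : gen_ideal s x -> gen_ideal s y -> gen_ideal s (x + y).
  by move=> hx hy; apply/asboolP; apply: (@rpredD _ (gen_ideal_pred s)); apply/asboolP.
have sP i : (i < size s)%N -> gen_ideal s s`_i.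
  move=> il; apply/gen_idealE; exists (fun j => (j == i)%:R).
  rewrite big_mkord (bigD1 (Ordinal il)) //= eqxx mul1r big1 ?addr0 // => j.
  by rewrite -val_eqE => /= /negbTE ->; rewrite mul0r.
pose Q := quotient_ring s; pose pr : {rmorphism P -> Q} := to_quotient s.
pose prk : {rmorphism {mpoly k[n]} -> quotient_ring sk} := to_quotient sk.
have [|q qE] := rmorphism_factor (g := prk \o reduction) (@to_quotient_surj _ s).
  move=> F /to_quotient_eq0 F0; apply/to_quotient_eq0/lift_ideal.
  by exists F => //; exists 0; rewrite mulr0 addr0.
have [|Phi PhiE] := rmorphism_factor (g := pr \o Frobenius_lift D) (@to_quotient_surj _ s).
  move=> F /to_quotient_eq0/gen_idealE[c ->]; apply/to_quotient_eq0.
  rewrite /= rmorph_sum big_nat; apply: (big_ind (gen_ideal s)) => //.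
    by apply/to_quotient_eq0; rewrite rmorph0.
  move=> i /andP[_ il]; rewrite rmorphM /=; apply: (idealM).
  have [d -> dI] := del i il; apply: (idealD).
    by rewrite expr2; apply/idealM/sP.
  have [G sG [H ->]] := (lift_ideal _).1 dI.
  by rewrite mulrDr mulrA mpoly_witt_4 mul0r addr0; apply: (idealM).
pose st' : {rmorphism W -> Q} := pr \o @mpolyC n W.
apply: (affine_F_liftable (st' := st') (q := q) (Phi := Phi)).
- move=> a; have [b <-] := to_quotient_surj a; have [F <-] := reduction_surj b.
  by exists (pr F); rewrite qE.
- move=> a'; have [F <-] := to_quotient_surj a'; rewrite qE; split.
    move=> /to_quotient_eq0 /lift_ideal[G /to_quotient_eq0 G0 [H ->]].
    have {}G0 : pr G = 0 by [].
    by exists (pr H); rewrite [LHS](rmorphD pr) G0 add0r rmorphM rmorph_nat.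
  move=> [b]; have [H <-] := to_quotient_surj b => e.
  apply/to_quotient_eq0/lift_ideal; exists (F - 2%:R * H).
    by apply/to_quotient_eq0; rewrite rmorphB rmorphM rmorph_nat /= e subrr.
  by exists H; rewrite subrK.
- move=> a'; have [F <-] := to_quotient_surj a'.
  move=> F2'; have /to_quotient_eq0 F2 : pr (2%:R * F) = 0.
    by rewrite rmorphM rmorph_nat.
  have [|y sy yE] := syz _ F2; first by apply/reduction_eq0; exists F.
  have [|H HE] := (reduction_eq0 (F - y)).1.
    by apply: reduction_ann2; rewrite mulrBr yE subrr.
  exists (pr H); transitivity (pr (2%:R * H)); last by rewrite rmorphM rmorph_nat.
  have y0 : pr y = 0 by apply/to_quotient_eq0.
  by rewrite -HE rmorphB y0 subr0.
- by move=> w; rewrite /st' /= qE /= reductionC.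
- by move=> w; rewrite /st' /= PhiE /= Frobenius_liftC.
- move=> a'; have [F <-] := to_quotient_surj a'; rewrite PhiE /= !qE /=.
  by rewrite reduction_Frobenius rmorphXn.
Qed.
End MpolyLift.

(** * Regular sequences *)

Section FewGenerators.
Variables (k : closedFieldType) (chk : 2%N \in [pchar k]) (n : nat).
Local Notation P := {mpoly (witt2 chk)[n]}.

(** Over the domain k[x_1, ..., x_n] the reduction of [f] is a nonzerodivisor, so a multiple c f
    reduces to 0 only if c is divisible by 2. *)
Lemma F_liftable_hypersurface (D : 'I_n -> P) (f d : P) :
  reduction f != 0 -> has_delta D f d -> gen_ideal [:: reduction f] (reduction d) ->
  F_liftable chk (Spec_quotient_structure [:: reduction f]).
Proof.
move=> f0 fd fI; apply: (F_liftable_quotient (D := D) (s := [:: f])).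
  move=> x /gen_idealE[c]; rewrite big_nat1 /= => -> /eqP.
  rewrite rmorphM mulf_eq0 (negbTE f0) orbF => /eqP/reduction_eq0[h ->].
  exists (h * f); last by rewrite mulrA.
  by apply/gen_idealE; exists (fun=> h); rewrite big_nat1.
by case=> // _; exists d.
Qed.

Lemma F_liftable_complete_intersection (D : 'I_n -> P) (f g d e : P) :
  (forall h1 h2, h1 * reduction f + h2 * reduction g = 0 ->
     exists c, h1 = c * reduction g /\ h2 = - c * reduction f) ->
  has_delta D f d -> gen_ideal [:: reduction f; reduction g] (reduction d) ->
  has_delta D g e -> gen_ideal [:: reduction f; reduction g] (reduction e) ->
  F_liftable chk (Spec_quotient_structure [:: reduction f; reduction g]).
Proof.
move=> reg fd fI ge gI; apply: (F_liftable_quotient (D := D) (s := [:: f; g])).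
  move=> x /gen_idealE[c]; rewrite big_nat_recl // big_nat1 /= => ->.
  rewrite rmorphD !rmorphM => /reg[r [r0 r1]]; have [R RE] := reduction_surj chk r.
  (* Subtracting the lifted Koszul syzygy (R g, -R f) does not change the combination and makes both
     coefficients divisible by 2. *)
  have [|h0 h0E] := (reduction_eq0 (c 0%N - R * g)).1.
    by rewrite rmorphB rmorphM /= RE r0 subrr.
  have [|h1 h1E] := (reduction_eq0 (c 1%N + R * f)).1.
    by rewrite rmorphD rmorphM /= RE r1 mulNr addNr.
  exists (h0 * f + h1 * g).
    apply/gen_idealE; exists (fun i => if i == 0%N then h0 else h1).
    by rewrite big_nat_recl // big_nat1.
  by rewrite mulrDr !mulrA -h0E -h1E; ring.
by case=> [|[|//]] _; [exists d | exists e].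
Qed.
End FewGenerators.

(** The remainder of [H] by [F], times the constant [r], is a multiple of the monic [F] of smaller
    degree, hence 0. *)
Lemma monic_dvd_mulC (S : idomainType) (F H Q : {poly S}) (r : S) :
  F \is monic -> r != 0 -> H * r%:P = F * Q -> exists Q', H = F * Q'.
Proof.
move=> monF r0 e.
have divE := Pdiv.RingMonic.rdivp_eq monF H.
set q := Pdiv.Ring.rdivp H F in divE; set m := Pdiv.Ring.rmodp H F in divE.
have szm : (size m < size F)%N by apply/Pdiv.Ring.ltn_rmodpN0/monic_neq0.
have mE : m * r%:P = F * (Q - q * r%:P).
  by rewrite mulrBr -e [in RHS]divE; ring.
exists q; suff m0 : m = 0 by rewrite divE m0 addr0 mulrC.
have [m0|m0] := eqVneq m 0; first by [].
have : size (m * r%:P) = size m by rewrite mulrC mul_polyC size_scale.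
rewrite mE size_monicM //; last first.
  apply: contra_neq m0 => Q0; move/eqP: mE; rewrite Q0 mulr0 mulf_eq0 polyC_eq0.
  by rewrite (negbTE r0) orbF => /eqP.
have : Q - q * r%:P != 0.
  by apply: contraNneq m0 => Q0; move/eqP: mE; rewrite Q0 mulr0 mulf_eq0 polyC_eq0 (negbTE r0) orbF.
rewrite -size_poly_gt0; case: (size (Q - _)) => // l _ /= lm.
by move: szm; rewrite -lm addnS /= ltnNge leq_addr.
Qed.

Section LastVariable.
Variable k : fieldType.

(** k[x, y, z, w] seen as k[x, y, z][w], where the first equation is monic. *)
Definition to_last : {mpoly k[4]} -> {poly {mpoly k[3]}} :=
  mmap (polyC \o @mpolyC 3 k)
    (fun i => if (i < 3)%N then ('X_(inord i))%:P else 'X).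
HB.instance Definition _ := GRing.RMorphism.on to_last.

Definition of_last : {poly {mpoly k[3]}} -> {mpoly k[4]} :=
  horner_eval 'X_(inord 3) \o
  map_poly (mmap (@mpolyC 4 k) (fun i : 'I_3 => 'X_(inord i))).
HB.instance Definition _ := GRing.RMorphism.on of_last.

Lemma to_lastK : cancel to_last of_last.
Proof.
apply: (mpoly_rmorphism_ext (f := of_last \o to_last) (g := idfun)) => [c|i] /=.
  rewrite /to_last /of_last mmapC /= map_polyC /horner_eval hornerC /=.
  by rewrite mmapC.
rewrite /to_last /of_last mmapX mmap1U /horner_eval /=; case: ifP => i3.
  rewrite map_polyC hornerC /= mmapX mmap1U.
  by congr 'X__; apply: val_inj; rewrite /= !inordK.
rewrite map_polyX hornerX; congr 'X__; apply: val_inj; rewrite /= inordK //.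
by apply/eqP; rewrite eqn_leq leqNgt i3 /= -ltnS ltn_ord.
Qed.

Lemma to_lastX i : (i < 4)%N ->
  to_last 'X_(inord i) = if (i < 3)%N then ('X_(inord i))%:P else 'X.
Proof. by move=> i4; rewrite /to_last mmapX mmap1U inordK. Qed.

Lemma regular_pair (a b c d : nat) :
  (0 < a)%N -> (0 < b)%N -> (0 < c)%N -> (0 < d)%N ->
  let x : {mpoly k[4]} := 'X_(inord 0) in
  let y : {mpoly k[4]} := 'X_(inord 1) in
  let z : {mpoly k[4]} := 'X_(inord 2) in
  let w : {mpoly k[4]} := 'X_(inord 3) in
  let f := x * y + z ^+ a + w ^+ b in
  let g := z * w + x ^+ c + y ^+ d in
  forall h1 h2, h1 * f + h2 * g = 0 -> exists r, h1 = r * g /\ h2 = - r * f.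
Proof.
move=> a0 b0 c0 d0 x y z w f g h1 h2 e.
(* [R] is z^b f with z w replaced by its value modulo g, so it is free of w. Then f divides h2 R
   and, being monic in w, divides h2. *)
pose R := z ^+ b * (x * y + z ^+ a) + (- (x ^+ c + y ^+ d)) ^+ b.
have [V RE] : exists V, R = z ^+ b * f - V * g.
  exists (\sum_(i < b) (z * w) ^+ (b.-1 - i) * (- (x ^+ c + y ^+ d)) ^+ i).
  have -> : g = z * w - - (x ^+ c + y ^+ d) by rewrite opprK /g addrA.
  rewrite [X in _ - X]mulrC -subrXX exprMn /R /f.
  by move: (z ^+ b) (w ^+ b) ((- _) ^+ b) => *; ring.
have h2R : h2 * R = f * (h2 * z ^+ b + V * h1).
  rewrite RE; apply/eqP; rewrite -subr_eq0; apply/eqP.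
  transitivity (- V * (h1 * f + h2 * g)); last by rewrite e mulr0.
  by move: (f) (g) (z ^+ b) => *; ring.
pose X i : {mpoly k[3]} := 'X_(inord i).
pose r := X 2 ^+ b * (X 0 * X 1 + X 2 ^+ a) + (- (X 0 ^+ c + X 1 ^+ d)) ^+ b.
have toR : to_last R = r%:P.
  by rewrite /R /r !(rmorphD, rmorphM, rmorphXn, rmorphN) /= !to_lastX //=.
have tof : to_last f = 'X^b + (X 0 * X 1 + X 2 ^+ a)%:P.
  by rewrite !(rmorphD, rmorphM, rmorphXn) /= !to_lastX //= addrC.
have monf : to_last f \is monic.
  rewrite tof monicE lead_coefDl ?lead_coefXn // size_polyXn.
  by rewrite (leq_ltn_trans (size_polyC_leq1 _)) // ltnS.
have r0 : r != 0.
  (* At the point (1, 0, 0) the value of [r] is (-1)^b. *)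
  apply/eqP => /(congr1 (meval (fun i : 'I_3 => (i == 0%N :> nat)%:R))).
  rewrite !(rmorphD, rmorphM, rmorphXn, rmorphN) /= !mevalXU !inordK //= meval0.
  rewrite !expr0n !expr1n !gtn_eqF // mul0r add0r addr0 => /eqP.
  by rewrite signr_eq0.
have [|Q h2Q] := monic_dvd_mulC (H := to_last h2)
  (Q := to_last (h2 * z ^+ b + V * h1)) monf r0.
  rewrite -toR; transitivity (to_last (h2 * R)); first by rewrite [RHS]rmorphM.
  by rewrite h2R rmorphM.
exists (- of_last Q).
have h2E : h2 = of_last Q * f.
  by rewrite -(to_lastK h2) h2Q rmorphM /= to_lastK mulrC.
split; last by rewrite opprK.
have f0 : f != 0.
  by apply: contraTneq monf => ->; rewrite rmorph0 monicE lead_coef0 eq_sym oner_neq0.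
apply: (mulIf f0); apply/eqP; rewrite -subr_eq0; apply/eqP; rewrite -[RHS]e h2E.
by move: (f) (g) => *; ring.
Qed.
End LastVariable.

(** * The membership problems in characteristic two *)

Section CharTwo.
Variable A : comNzRingType.
Hypothesis two0 : 2%:R = 0 :> A.

Lemma sqrrD2 (u v : A) : (u + v) ^+ 2 = u ^+ 2 + v ^+ 2.
Proof. by rewrite sqrrD -mulr_natl two0 mul0r addr0. Qed.

Lemma oppr2 (u : A) : - u = u.
Proof. by apply/eqP; rewrite eq_sym -addr_eq0 -mulr2n -mulr_natl two0 mul0r. Qed.

(* Here p, q, r stand for x^(a-2), y^(b-2), z^(c-2) and al, be, ga for the parities of
   a, b, c. *)
Definition deltas3 (x y z p q r al be ga m : A) := exists dx dy dz u h : A,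
  m = (al * (p * x) ^+ 2 + (y * z) ^+ 2) * dx
    + (be * (q * y) ^+ 2 + (x * z) ^+ 2) * dy
    + (ga * (r * z) ^+ 2 + (x * y) ^+ 2) * dz
    + u ^+ 2 + h * (p * x ^+ 2 + q * y ^+ 2 + r * z ^+ 2 + x * y * z).

Section Closure3.
Variables (x y z p q r al be ga : A).
Local Notation G := (deltas3 x y z p q r al be ga).

Lemma deltas3D m m' : G m -> G m' -> G (m + m').
Proof.
move=> [dx [dy [dz [u [h ->]]]]] [dx' [dy' [dz' [u' [h' ->]]]]].
exists (dx + dx'), (dy + dy'), (dz + dz'), (u + u'), (h + h').
by rewrite sqrrD2; ring.
Qed.

(** Membership is proved below by subtracting attainable elements until an evidently attainable one
    is left. *)
Lemma deltas3_sub m' m : G m' -> G (m - m') -> G m.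
Proof. by move=> h h'; rewrite -(subrK m' m); apply: deltas3D. Qed.

Lemma deltas3_sqr u : G (u ^+ 2).
Proof. by exists 0, 0, 0, u, 0; ring. Qed.

Lemma deltas3_rel h : G (h * (p * x ^+ 2 + q * y ^+ 2 + r * z ^+ 2 + x * y * z)).
Proof. by exists 0, 0, 0, 0, h; ring. Qed.

Lemma deltas3_dx t : G (t * (al * (p * x) ^+ 2 + (y * z) ^+ 2)).
Proof. by exists t, 0, 0, 0, 0; ring. Qed.

Lemma deltas3_swap m : G m -> deltas3 y x z q p r be al ga m.
Proof.
by move=> [dx [dy [dz [u [h ->]]]]]; exists dy, dx, dz, u, h; ring.
Qed.

Lemma deltas3_rot m : G m -> deltas3 y z x q r p be ga al m.
Proof.
by move=> [dx [dy [dz [u [h ->]]]]]; exists dy, dz, dx, u, h; ring.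
Qed.
End Closure3.

Lemma deltas3_dy x y z p q r al be ga t :
  deltas3 x y z p q r al be ga (t * (be * (q * y) ^+ 2 + (x * z) ^+ 2)).
Proof. exact/deltas3_swap/deltas3_dx. Qed.

Lemma deltas3_dz x y z p q r al be ga t :
  deltas3 x y z p q r al be ga (t * (ga * (r * z) ^+ 2 + (x * y) ^+ 2)).
Proof. by apply/deltas3_rot/deltas3_dx. Qed.

Lemma deltas3_even x y z p q r be ga t :
  deltas3 x y z p q r 0 be ga (t * (y * z) ^+ 2).
Proof.
by have := deltas3_dx x y z p q r 0 be ga t; rewrite mul0r add0r.
Qed.

(** The second elementary symmetric polynomial of p x^2, q y^2, r z^2. Products with the fourth
    monomial x y z add up to x y z f + (x y z)^2 modulo 2 and need no further work. *)
Definition quadratic (x y z p q r : A) :=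
  q * r * (y * z) ^+ 2 + p * r * (x * z) ^+ 2 + p * q * (x * y) ^+ 2.

Lemma deltas3_quadratic_rot x y z p q r al be ga :
  deltas3 x y z p q r al be ga (quadratic x y z p q r) ->
  deltas3 y z x q r p be ga al (quadratic y z x q r p).
Proof.
by move=> /deltas3_rot; congr deltas3; rewrite /quadratic; ring.
Qed.

Lemma deltas3_quadratic_even x y z p q r :
  deltas3 x y z p q r 0 0 0 (quadratic x y z p q r).
Proof.
apply: deltas3D; [apply: deltas3D|].
- exact: deltas3_even.
- exact/deltas3_swap/deltas3_even.
- exact/deltas3_rot/deltas3_even.
Qed.

(** As q and r are squares, replacing (y z)^2 by (p x)^2 turns the first term into a square. *)
Lemma deltas3_quadratic_odd1 x y z p q1 r1 (q := q1 ^+ 2) (r := r1 ^+ 2) :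
  deltas3 x y z p q r 1 0 0 (quadratic x y z p q r).
Proof.
apply: deltas3D; [apply: deltas3D|].
- apply: (deltas3_sub (deltas3_dx _ _ _ _ _ _ _ _ _ (q * r))).
  rewrite (_ : _ - _ = (q1 * r1 * p * x) ^+ 2); first exact: deltas3_sqr.
  by rewrite /q /r -[RHS]oppr2; ring.
- exact/deltas3_swap/deltas3_even.
- exact/deltas3_rot/deltas3_even.
Qed.

(* The hypothesis covers b >= 5; b = 3 and c >= 4; b = 3, c = 2 and a >= 7. *)
Lemma deltas3_odd2_aux x y z p1 q1 r1 (p := x * p1 ^+ 2) (q := y * q1 ^+ 2)
    (r := r1 ^+ 2) :
  [\/ exists q2, q1 = y * q2, q1 = 1 /\ (exists r2, r1 = z * r2)
    | [/\ q1 = 1, r1 = 1 & exists p2, p = x ^+ 4 * p2]] ->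
  deltas3 x y z p q r 1 1 0 (q * r * (y * z) ^+ 2).
Proof.
move=> h; have xy t : deltas3 x y z p q r 1 1 0 (t * (x * y) ^+ 2).
  exact/deltas3_rot/deltas3_even.
apply: (deltas3_sub (deltas3_dx _ _ _ _ _ _ _ _ _ (q * r))).
case: h => [[q2 q2E]|[q1E [r2 r2E]]|[q1E r1E [p2 p2E]]].
(* Here y^3 divides q, so q r (p x)^2 is a multiple of (x y)^2. *)
- rewrite (_ : _ - _ = - (y * q2 ^+ 2 * r * p ^+ 2) * (x * y) ^+ 2) //.
  by rewrite /q q2E; ring.
(* Here z^2 divides r, so the remainder contains (x z)^2, which is traded for (q y)^2 = y^4. *)
- apply: (deltas3_sub (deltas3_dy _ _ _ _ _ _ _ _ _ (- (y * r2 ^+ 2 * p ^+ 2)))).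
  rewrite (_ : _ - _ = (y ^+ 3 * r2 ^+ 2 * (p1 ^+ 4)) * (x * y) ^+ 2) //.
  by rewrite /q /p /r q1E r2E; ring.
(* Here the remainder is y p (p x^2), and the equation replaces p x^2 by y^3 + z^2 + x y z modulo 2;
   only y p z^2 then needs the trade of (x z)^2 for y^4. *)
- apply: (deltas3_sub (deltas3_rel _ _ _ _ _ _ _ _ _ (- (y * p)))).
  apply: (deltas3_sub (deltas3_dy _ _ _ _ _ _ _ _ _ (y * (x ^+ 2 * p2)))).
  rewrite (_ : _ - _ = (y ^+ 2 * x ^+ 2 * p2 + x ^+ 3 * p2 * z - y ^+ 3 * p2) * (x * y) ^+ 2) //.
  by rewrite /q /r q1E r1E p2E; ring.
Qed.

Lemma deltas3_quadratic_odd2 x y z i j l :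
  let a := i.*2.+3 in let b := j.*2.+3 in let c := l.*2.+2 in
  (b * c + a * c + a * b < a * b * c)%N ->
  let p := x * (x ^+ i) ^+ 2 in let q := y * (y ^+ j) ^+ 2 in
  let r := (z ^+ l) ^+ 2 in
  deltas3 x y z p q r 1 1 0 (quadratic x y z p q r).
Proof.
move=> a b c abc p q r.
have pow0 (t : A) n m : n = 0%N -> t ^+ (n + m) = t ^+ m by move=> ->.
have aux (u v : A) m n : (n.*2.+3 * c + m.*2.+3 * c + m.*2.+3 * n.*2.+3
      < m.*2.+3 * n.*2.+3 * c)%N ->
    [\/ exists q2, v ^+ n = v * q2, v ^+ n = 1 /\ (exists r2, z ^+ l = z * r2)
      | [/\ v ^+ n = 1, z ^+ l = 1 & exists p2, u * (u ^+ m) ^+ 2 = u ^+ 4 * p2]].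
  case: n => [|n] mn; last by apply: Or31; exists (v ^+ n); rewrite exprS.
  case: l @r @c abc mn => [|l] r c abc mn.
    (* With exponents 3 and 2 for the other two variables, the inequality forces the third exponent
       to be at least 7. *)
    apply: Or33; split=> //; case: m mn => [|[|m]]; rewrite /c //= => _.
    exists (u * (u ^+ m) ^+ 2); rewrite !exprS; move: (u ^+ m) => t; ring.
  by apply: Or32; split=> //; exists (z ^+ l); rewrite exprS.
rewrite /quadratic; apply: deltas3D; [apply: deltas3D|].
- exact/deltas3_odd2_aux/aux.
- apply/deltas3_swap/deltas3_odd2_aux/aux.
  by move: abc; rewrite (addnC (b * c)%N) (mulnC a b).
- exact/deltas3_rot/deltas3_even.
Qed.

(** The three congruences leave p q r (p x^2 + q y^2 + r z^2), which the equation turns into p q r x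
    y z; this is a square as all exponents are odd. *)
Lemma deltas3_quadratic_odd3 x y z p1 q1 r1 (p := x * p1 ^+ 2) (q := y * q1 ^+ 2)
    (r := z * r1 ^+ 2) :
  deltas3 x y z p q r 1 1 1 (quadratic x y z p q r).
Proof.
apply: (deltas3_sub (deltas3_dx _ _ _ _ _ _ _ _ _ (q * r))).
apply: (deltas3_sub (deltas3_dy _ _ _ _ _ _ _ _ _ (p * r))).
apply: (deltas3_sub (deltas3_dz _ _ _ _ _ _ _ _ _ (p * q))).
apply: (deltas3_sub (deltas3_rel _ _ _ _ _ _ _ _ _ (- (p * q * r)))).
rewrite (_ : _ - _ = (x * y * z * p1 * q1 * r1) ^+ 2); first exact: deltas3_sqr.
by rewrite /p /q /r /quadratic; ring.
Qed.

Lemma exp_parity (x : A) (a : nat) : (2 <= a)%N ->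
  exists i, (a = i.*2.+2 /\ a%:R = 0 :> A /\ x ^+ (a - 2) = (x ^+ i) ^+ 2) \/
    (a = i.*2.+3 /\ a%:R = 1 :> A /\ x ^+ (a - 2) = x * (x ^+ i) ^+ 2).
Proof.
case: a => [|[|a]] // _; exists a./2; rewrite subSS subSS subn0.
have even m : m.*2%:R = 0 :> A by rewrite -mul2n natrM two0 mul0r.
move: (odd_double_half a); case: (odd a); move: a./2 => i <-; [right|left].
  rewrite add1n -doubleS -addn1 natrD even add0r addn1 doubleS.
  by split=> //; split=> //; rewrite exprS -exprM muln2.
rewrite add0n -doubleS even doubleS.
by split=> //; split=> //; rewrite -exprM muln2.
Qed.

Lemma deltas3_quadratic x y z a b c :
  (b * c + a * c + a * b < a * b * c)%N ->
  (2 <= a)%N -> (2 <= b)%N -> (2 <= c)%N ->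
  let p := x ^+ (a - 2) in let q := y ^+ (b - 2) in let r := z ^+ (c - 2) in
  deltas3 x y z p q r a%:R b%:R c%:R (quadratic x y z p q r).
Proof.
move=> abc a2 b2 c2 p q r; rewrite /p /q /r.
have [i [[aE [-> ->]]|[aE [-> ->]]]] := exp_parity x a2;
have [j [[bE [-> ->]]|[bE [-> ->]]]] := exp_parity y b2;
have [l [[cE [-> ->]]|[cE [-> ->]]]] := exp_parity z c2.
- exact: deltas3_quadratic_even.
- exact/deltas3_quadratic_rot/deltas3_quadratic_odd1.
- exact/deltas3_quadratic_rot/deltas3_quadratic_rot/deltas3_quadratic_odd1.
- apply/deltas3_quadratic_rot/deltas3_quadratic_rot/deltas3_quadratic_odd2.
  by rewrite -aE -bE -cE; lia.
- exact: deltas3_quadratic_odd1.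
- apply/deltas3_quadratic_rot/deltas3_quadratic_odd2.
  by rewrite -aE -bE -cE; lia.
- by apply: deltas3_quadratic_odd2; rewrite -aE -bE -cE.
- exact: deltas3_quadratic_odd3.
Qed.

Section TwoEquations.
(* p, q, r, s stand for z^(a-2), w^(b-2), x^(c-2), y^(d-2), and al, be, ga, de for the
   parities of a, b, c, d. *)
Variables (x y z w p q r s al be ga de : A).
Let f := x * y + p * z ^+ 2 + q * w ^+ 2.
Let g := z * w + r * x ^+ 2 + s * y ^+ 2.

(** The same [dx], [dy], [dz], [dw] must serve both equations, with the squared partial derivatives
    as coefficients; the squares and the multiples of [f] and [g] are chosen independently. *)
Definition deltas4 (m n : A) := exists dx dy dz dw u v h1 h2 h3 h4 : A,
  m = y ^+ 2 * dx + x ^+ 2 * dy + al * (p * z) ^+ 2 * dz + be * (q * w) ^+ 2 * dw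
      + u ^+ 2 + h1 * f + h2 * g /\
  n = ga * (r * x) ^+ 2 * dx + de * (s * y) ^+ 2 * dy + w ^+ 2 * dz + z ^+ 2 * dw
      + v ^+ 2 + h3 * f + h4 * g.

Lemma deltas4D m n m' n' : deltas4 m n -> deltas4 m' n' -> deltas4 (m + m') (n + n').
Proof.
move=> [dx [dy [dz [dw [u [v [h1 [h2 [h3 [h4 [-> ->]]]]]]]]]]].
move=> [dx' [dy' [dz' [dw' [u' [v' [h1' [h2' [h3' [h4' [-> ->]]]]]]]]]]].
exists (dx + dx'), (dy + dy'), (dz + dz'), (dw + dw'), (u + u'), (v + v').
exists (h1 + h1'), (h2 + h2'), (h3 + h3'), (h4 + h4').
by rewrite !sqrrD2; split; ring.
Qed.

Lemma deltas4_sub m' n' m n :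
  deltas4 m' n' -> deltas4 (m - m') (n - n') -> deltas4 m n.
Proof. by move=> h h'; rewrite -(subrK m' m) -(subrK n' n); apply: deltas4D. Qed.

Lemma deltas4_sqr u v : deltas4 (u ^+ 2) (v ^+ 2).
Proof. by exists 0, 0, 0, 0, u, v, 0, 0, 0, 0; split; ring. Qed.

(** [t] and [t'] collect the multiples of 2, so that an identity valid in any commutative ring
    remains. *)
Lemma deltas4_rel h1 h2 t h3 h4 t' m n :
  m = h1 * f + h2 * g + 2%:R * t -> n = h3 * f + h4 * g + 2%:R * t' -> deltas4 m n.
Proof.
rewrite two0 !mul0r => -> ->.
by exists 0, 0, 0, 0, 0, 0, h1, h2, h3, h4; split; ring.
Qed.

Lemma deltas4_dx t : deltas4 (y ^+ 2 * t) (ga * (r * x) ^+ 2 * t).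
Proof. by exists t, 0, 0, 0, 0, 0, 0, 0, 0, 0; split; ring. Qed.

Lemma deltas4_dy t : deltas4 (x ^+ 2 * t) (de * (s * y) ^+ 2 * t).
Proof. by exists 0, t, 0, 0, 0, 0, 0, 0, 0, 0; split; ring. Qed.

Lemma deltas4_dz t : deltas4 (al * (p * z) ^+ 2 * t) (w ^+ 2 * t).
Proof. by exists 0, 0, t, 0, 0, 0, 0, 0, 0, 0; split; ring. Qed.

Lemma deltas4_dw t : deltas4 (be * (q * w) ^+ 2 * t) (z ^+ 2 * t).
Proof. by exists 0, 0, 0, t, 0, 0, 0, 0, 0, 0; split; ring. Qed.

(* Modulo g and 2, (zw)^2 is r^2 x^4 + s^2 y^4, which dx and dy absorb. *)
Lemma deltas4_zw t :
  deltas4 (t * (z * w) ^+ 2) ((ga + de) * t * (r * s * (x * y)) ^+ 2).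
Proof.
apply: (deltas4_sub (deltas4_dx (t * s ^+ 2 * y ^+ 2))).
apply: (deltas4_sub (deltas4_dy (t * r ^+ 2 * x ^+ 2))).
by apply: (@deltas4_rel 0 (t * (z * w - r * x ^+ 2 - s * y ^+ 2))
  (t * r * s * (x * y) ^+ 2) 0 0 0); rewrite /g; ring.
Qed.

(** The mirror image: modulo f and 2, (x y)^2 is p^2 z^4 + q^2 w^4, which [dz] and [dw] absorb at
    the price of an error in the first equation. *)
Lemma deltas4_xy t :
  deltas4 ((al + be) * t * (p * q * (z * w)) ^+ 2) (t * (x * y) ^+ 2).
Proof.
apply: (deltas4_sub (deltas4_dz (t * q ^+ 2 * w ^+ 2))).
apply: (deltas4_sub (deltas4_dw (t * p ^+ 2 * z ^+ 2))).
by apply: (@deltas4_rel 0 0 0 (t * (x * y - p * z ^+ 2 - q * w ^+ 2)) 0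
  (t * p * q * (z * w) ^+ 2)); rewrite /f; ring.
Qed.

(** If exactly one of a, b is odd, that exponent is at least 3, so the corresponding power z^(a-2)
    or w^(b-2) contains its variable. *)
Hypothesis parity_ab : al + be = 0 \/
  (al = 0 /\ exists q1, q = w * q1) \/ (be = 0 /\ exists p1, p = z * p1).
Hypothesis parity_cd : ga + de = 0 \/
  (ga = 0 /\ exists s1, s = y * s1) \/ (de = 0 /\ exists r1, r = x * r1).

Lemma deltas4_eq m n m' n' : deltas4 m' n' -> m = m' -> n = n' -> deltas4 m n.
Proof. by move=> h -> ->. Qed.

(** The variable with even exponent has zero derivative in [f], so its correction affects only the
    second equation; the odd exponent supplies the square factor needed there. *)
Lemma deltas4_right_pq : al + be <> 0 -> forall t, deltas4 0 ((p * q) ^+ 2 * t).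
Proof.
move=> albe t; case: parity_ab => [//|[[al0 [q1 q1E]]|[be0 [p1 p1E]]]].
  by apply: (deltas4_eq (deltas4_dz (p ^+ 2 * q1 ^+ 2 * t))); rewrite ?al0 ?q1E; ring.
by apply: (deltas4_eq (deltas4_dw (p1 ^+ 2 * q ^+ 2 * t))); rewrite ?be0 ?p1E; ring.
Qed.

Lemma deltas4_left_rs : ga + de <> 0 -> forall t, deltas4 ((r * s) ^+ 2 * t) 0.
Proof.
move=> gade t; case: parity_cd => [//|[[ga0 [s1 s1E]]|[de0 [r1 r1E]]]].
  by apply: (deltas4_eq (deltas4_dx (r ^+ 2 * s1 ^+ 2 * t))); rewrite ?ga0 ?s1E; ring.
by apply: (deltas4_eq (deltas4_dy (r1 ^+ 2 * s ^+ 2 * t))); rewrite ?de0 ?r1E; ring.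
Qed.

Lemma deltas4_left : deltas4 (p * q * (z * w) ^+ 2) 0.
Proof.
apply: (deltas4_sub (deltas4_zw (p * q))); have [gade|gade] := eqVneq (ga + de) 0.
  by apply: (deltas4_eq (deltas4_sqr 0 0)); rewrite ?gade; ring.
(* This cancels the error in the second equation; the new error in the first is divisible by (r
   s)^2, and [deltas4_left_rs] removes it. *)
apply: (deltas4_sub (deltas4_xy (- ((ga + de) * p * q * (r * s) ^+ 2)))).
apply: (deltas4_eq (deltas4_left_rs (elimN eqP gade) (
  (al + be) * (ga + de) * p * q * (p * q * (z * w)) ^+ 2))); ring.
Qed.

Lemma deltas4_right : deltas4 0 (r * s * (x * y) ^+ 2).
Proof.
apply: (deltas4_sub (deltas4_xy (r * s))); have [albe|albe] := eqVneq (al + be) 0.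
  by apply: (deltas4_eq (deltas4_sqr 0 0)); rewrite ?albe; ring.
apply: (deltas4_sub (deltas4_zw (- ((al + be) * r * s * (p * q) ^+ 2)))).
apply: (deltas4_eq (deltas4_right_pq (elimN eqP albe) (
  (al + be) * (ga + de) * r * s * (r * s * (x * y)) ^+ 2))); ring.
Qed.

(** The first entry is p q (z w)^2 + x y f - (x y)^2, the second r s (x y)^2 + z w g - (z w)^2. They
    are grouped as [has_deltaD] produces them. *)
Lemma deltas4_pair_products :
  deltas4 (x * y * (p * z ^+ 2) + (x * y + p * z ^+ 2) * (q * w ^+ 2))
          (z * w * (r * x ^+ 2) + (z * w + r * x ^+ 2) * (s * y ^+ 2)).
Proof.
apply: (deltas4_sub deltas4_left); apply: (deltas4_sub deltas4_right).
apply: (deltas4_sub (deltas4_sqr (x * y) (z * w))).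
by apply: (@deltas4_rel (x * y) 0 (- (x * y) ^+ 2) 0 (z * w) (- (z * w) ^+ 2));
  rewrite /f /g; ring.
Qed.

End TwoEquations.
End CharTwo.

(** * The two families of singularities *)

Lemma exprB2 (R : comNzRingType) (x : R) n : (2 <= n)%N -> x ^+ n = x ^+ (n - 2) * x ^+ 2.
Proof. by move=> n2; rewrite -exprD subnK. Qed.

Lemma exprB1 (R : comNzRingType) (x : R) n :
  (2 <= n)%N -> x ^+ (2 * n.-1) = (x ^+ (n - 2) * x) ^+ 2.
Proof.
by move=> n2; rewrite -exprSr -exprM mulnC; congr (x ^+ (_ * _)); lia.
Qed.

Section Main.
Variables (k : closedFieldType) (chk : 2%N \in [pchar k]).

Lemma mpoly_two0 n : 2%:R = 0 :> {mpoly k[n]}.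
Proof. by rewrite -(rmorph_nat (@mpolyC n k)) (pcharf0 chk) rmorph0. Qed.

Lemma hyperbolic_exponents (a b c : nat) : (0 < a)%N -> (0 < b)%N -> (0 < c)%N ->
  (a%:R^-1 + b%:R^-1 + c%:R^-1 < 1 :> rat) ->
  (b * c + a * c + a * b < a * b * c)%N.
Proof.
move=> a0 b0 c0; rewrite -(Num.Theory.ltr_nat rat) !natrD !natrM.
have pos n : (0 < n)%N -> (0 : rat) < n%:R by rewrite Num.Theory.ltr0n.
have abc0 : (0 : rat) < a%:R * b%:R * c%:R by rewrite !Num.Theory.mulr_gt0 ?pos.
rewrite -(Num.Theory.ltr_pM2l abc0) mulr1.
suff -> : a%:R * b%:R * c%:R * (a%:R^-1 + b%:R^-1 + c%:R^-1) =
  b%:R * c%:R + a%:R * c%:R + a%:R * b%:R :> rat by [].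
by field; rewrite !Num.Theory.lt0r_neq0 ?pos.
Qed.

Lemma F_liftable_cusp (a b c : nat) :
  (b * c + a * c + a * b < a * b * c)%N ->
  let x : {mpoly k[3]} := 'X_(inord 0) in
  let y : {mpoly k[3]} := 'X_(inord 1) in
  let z : {mpoly k[3]} := 'X_(inord 2) in
  let f := x ^+ a + y ^+ b + z ^+ c + x * y * z in
  F_liftable chk (Spec_quotient_structure [:: f]).
Proof.
move=> abc x y z f; have two0 := mpoly_two0 3.
have a2 : (2 <= a)%N by case: a abc {f} => [|[|a]] // abc; exfalso; nia.
have b2 : (2 <= b)%N by case: b abc {f} => [|[|b]] // abc; exfalso; nia.
have c2 : (2 <= c)%N by case: c abc {f} => [|[|c]] // abc; exfalso; nia.
have /= [dx [dy [dz [u [h mE]]]]] := deltas3_quadratic two0 x y z abc a2 b2 c2.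
have [Dx DxE] := reduction_surj chk dx; have [Dy DyE] := reduction_surj chk dy.
have [Dz DzE] := reduction_surj chk dz.
(* The summand x y z provides the square (x y z)^2 left by the products with the monomial x y z. *)
have [U UE] := reduction_surj chk (u + x * y * z).
pose D (i : 'I_3) := nth 0 [:: Dx; Dy; Dz] i.
pose X i : {mpoly (witt2 chk)[3]} := 'X_(inord i).
pose F := X 0%N ^+ a + X 1%N ^+ b + X 2%N ^+ c + X 0%N * X 1%N * X 2%N + 2%:R * U.
have redX i : reduction (X i) = 'X_(inord i) by apply: reductionX.
have redF : reduction F = f.
  by rewrite /F !(rmorphD, rmorphM, rmorphXn, rmorph_nat) /= !redX two0 mul0r addr0.
have DX i (i3 : (i < 3)%N) : has_delta D (X i) (nth 0 [:: Dx; Dy; Dz] i).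
  by have := has_deltaX D (inord i); rewrite /D inordK.
have dX := DX 0%N isT; have dY := DX 1%N isT; have dZ := DX 2%N isT.
have dF := has_deltaD (has_deltaD (has_deltaD (has_deltaD
  (has_delta_exp a dX) (has_delta_exp b dY)) (has_delta_exp c dZ))
  (has_deltaM (has_deltaM dX dY) dZ)) (has_delta_double D U).
rewrite -redF; apply: F_liftable_hypersurface dF _.
  (* The value of [f] at (1, 0, 0) is 1. *)
  rewrite redF; apply/eqP => /(congr1 (meval (fun i : 'I_3 => (i == 0%N :> nat)%:R))).
  rewrite /f !(rmorphD, rmorphM, rmorphXn) /= !mevalXU !inordK //= meval0.
  rewrite !expr0n !expr1n !gtn_eqF 1?ltnW // mulr0 !addr0 => /eqP.
  by rewrite oner_eq0.
apply/gen_idealE; exists (fun=> - (h + x * y * z)); rewrite big_nat1 /= redF /f.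
rewrite !(rmorph_nat, rmorphD, rmorphXn, rmorphM, rmorphN) /= !redX DxE DyE DzE UE.
rewrite -/x -/y -/z !exprB1 // !(exprB2 x a2, exprB2 y b2, exprB2 z c2).
move: mE; rewrite /quadratic.
move: (x ^+ (a - 2)) (y ^+ (b - 2)) (z ^+ (c - 2)) => p q r /eqP.
rewrite -subr_eq0 => /eqP mE; apply/eqP; rewrite -subr_eq0 -oppr_eq0 -mE.
rewrite -subr_eq0; apply/eqP.
(* Over the integers the two sides differ by this explicit multiple of 2. *)
transitivity (2%:R * (- (u * x * y * z + (x * y * z) ^+ 2) +
  (p * x ^+ 2 + q * y ^+ 2 + r * z ^+ 2 + x * y * z) * (u + x * y * z)));
  last by rewrite two0 mul0r.
by ring.
Qed.
Lemma parity_pair (R : comNzRingType) (u v : R) m n :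
  2%:R = 0 :> R -> (2 <= m)%N -> (2 <= n)%N ->
  m%:R + n%:R = 0 :> R \/ (m%:R = 0 :> R /\ exists v1, v ^+ (n - 2) = v * v1) \/
    (n%:R = 0 :> R /\ exists u1, u ^+ (m - 2) = u * u1).
Proof.
move=> two0 m2 n2.
have [i [[_ [-> _]]|[_ [-> uE]]]] := exp_parity two0 u m2;
have [j [[_ [-> _]]|[_ [-> vE]]]] := exp_parity two0 v n2.
- by left; rewrite addr0.
- by right; left; split=> //; exists ((v ^+ j) ^+ 2).
- by right; right; split=> //; exists ((u ^+ i) ^+ 2).
- by left; rewrite -two0 mulr2n.
Qed.

Lemma gen_ideal_pair (R : comNzRingType) (f g x c d : R) :
  x = c * f + d * g -> gen_ideal [:: f; g] x.
Proof.
move=> ->; apply/gen_idealE; exists (fun i => if i == 0%N then c else d).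
by rewrite big_nat_recl // big_nat1.
Qed.

Lemma F_liftable_complete_intersection4 (a b c d : nat) :
  (2 <= a)%N -> (2 <= b)%N -> (2 <= c)%N -> (2 <= d)%N ->
  let x : {mpoly k[4]} := 'X_(inord 0) in
  let y : {mpoly k[4]} := 'X_(inord 1) in
  let z : {mpoly k[4]} := 'X_(inord 2) in
  let w : {mpoly k[4]} := 'X_(inord 3) in
  let f := x * y + z ^+ a + w ^+ b in
  let g := z * w + x ^+ c + y ^+ d in
  F_liftable chk (Spec_quotient_structure [:: f; g]).
Proof.
move=> a2 b2 c2 d2 x y z w f g; have two0 := mpoly_two0 4.
have [dx [dy [dz [dw [u [v [h1 [h2 [h3 [h4 [mE nE]]]]]]]]]]] :=
  deltas4_pair_products two0 (parity_pair z w two0 a2 b2)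
    (parity_pair x y two0 c2 d2).
have [Dx DxE] := reduction_surj chk dx; have [Dy DyE] := reduction_surj chk dy.
have [Dz DzE] := reduction_surj chk dz; have [Dw DwE] := reduction_surj chk dw.
have [U UE] := reduction_surj chk u; have [V VE] := reduction_surj chk v.
pose D (i : 'I_4) := nth 0 [:: Dx; Dy; Dz; Dw] i.
pose X i : {mpoly (witt2 chk)[4]} := 'X_(inord i).
pose F := X 0%N * X 1%N + X 2%N ^+ a + X 3%N ^+ b + 2%:R * U.
pose G := X 2%N * X 3%N + X 0%N ^+ c + X 1%N ^+ d + 2%:R * V.
have redX i : reduction (X i) = 'X_(inord i) by apply: reductionX.
have redF : reduction F = f.
  by rewrite /F !(rmorphD, rmorphM, rmorphXn, rmorph_nat) /= !redX two0 mul0r addr0.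
have redG : reduction G = g.
  by rewrite /G !(rmorphD, rmorphM, rmorphXn, rmorph_nat) /= !redX two0 mul0r addr0.
have DX i (i4 : (i < 4)%N) : has_delta D (X i) (nth 0 [:: Dx; Dy; Dz; Dw] i).
  by have := has_deltaX D (inord i); rewrite /D inordK.
have dX := DX 0%N isT; have dY := DX 1%N isT.
have dZ := DX 2%N isT; have dW := DX 3%N isT.
have dF := has_deltaD (has_deltaD (has_deltaD (has_deltaM dX dY)
  (has_delta_exp a dZ)) (has_delta_exp b dW)) (has_delta_double D U).
have dG := has_deltaD (has_deltaD (has_deltaD (has_deltaM dZ dW)
  (has_delta_exp c dX)) (has_delta_exp d dY)) (has_delta_double D V).
rewrite -redF -redG; apply: F_liftable_complete_intersection dF _ dG _.
- by rewrite redF redG; apply: regular_pair; apply: ltnW.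
- rewrite redF redG; apply: (gen_ideal_pair (c := - h1) (d := - h2)).
  rewrite !(rmorph_nat, rmorphD, rmorphXn, rmorphM, rmorphN) /= !redX.
  rewrite DxE DyE DzE DwE UE /f /g -/x -/y -/z -/w !exprB1 //.
  rewrite !(exprB2 z a2, exprB2 w b2, exprB2 x c2, exprB2 y d2).
  move: mE {nE}.
  move: (x ^+ (c - 2)) (y ^+ (d - 2)) (z ^+ (a - 2)) (w ^+ (b - 2)) => r s p q /eqP.
  rewrite -subr_eq0 => /eqP mE; apply/eqP; rewrite -subr_eq0 -oppr_eq0 -mE.
  by rewrite two0 mul0r -subr_eq0; apply/eqP; ring.
- rewrite redF redG; apply: (gen_ideal_pair (c := - h3) (d := - h4)).
  rewrite !(rmorph_nat, rmorphD, rmorphXn, rmorphM, rmorphN) /= !redX.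
  rewrite DxE DyE DzE DwE VE /f /g -/x -/y -/z -/w !exprB1 //.
  rewrite !(exprB2 z a2, exprB2 w b2, exprB2 x c2, exprB2 y d2).
  move: nE {mE}.
  move: (x ^+ (c - 2)) (y ^+ (d - 2)) (z ^+ (a - 2)) (w ^+ (b - 2)) => r s p q /eqP.
  rewrite -subr_eq0 => /eqP mE; apply/eqP; rewrite -subr_eq0 -oppr_eq0 -mE.
  by rewrite two0 mul0r -subr_eq0; apply/eqP; ring.
Qed.
End Main.

Theorem proposition4p16 (k : closedFieldType) (chk : 2%N \in [pchar k]) :
  (forall a b c : nat, (0 < a)%N -> (0 < b)%N -> (0 < c)%N ->
     (a%:R^-1 + b%:R^-1 + c%:R^-1 < 1 :> rat) ->
     let x : {mpoly k[3]} := 'X_(inord 0) in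
     let y : {mpoly k[3]} := 'X_(inord 1) in
     let z : {mpoly k[3]} := 'X_(inord 2) in
     let f := x ^+ a + y ^+ b + z ^+ c + x * y * z in
     F_liftable chk (Spec_quotient_structure [:: f]))
  /\
  (forall a b c d : nat, (2 <= a)%N -> (2 <= b)%N -> (2 <= c)%N -> (2 <= d)%N ->
     [|| 3 <= a, 3 <= b, 3 <= c | 3 <= d]%N ->
     let x : {mpoly k[4]} := 'X_(inord 0) in
     let y : {mpoly k[4]} := 'X_(inord 1) in
     let z : {mpoly k[4]} := 'X_(inord 2) in
     let w : {mpoly k[4]} := 'X_(inord 3) in
     let f := x * y + z ^+ a + w ^+ b in
     let g := z * w + x ^+ c + y ^+ d in
     F_liftable chk (Spec_quotient_structure [:: f; g])).
Proof.
split=> [a b c a0 b0 c0 abc|a b c d a2 b2 c2 d2 _].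
  exact: F_liftable_cusp (hyperbolic_exponents a0 b0 c0 abc).
exact: F_liftable_complete_intersection4.
Qed.
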